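(* Let $(\mathcal{E},\circ)$ be a Euclidean Jordan algebra of rank $r$, let $f:\mathbb{R}^r\to[-\infty,+\infty]$ be a symmetric function, and let $F:\mathcal{E}\to[-\infty,+\infty]$, $F(x)=f(\lambda(x))$, be the spectral function induced by $f$. Let $\Diamond$ be any one of the regular subdifferential $\hat\partial$, the approximate subdifferential $\partial$, or the horizon subdifferential $\partial^\infty$. Then for every $x\in\mathcal{E}$, $$\Diamond F(x)=\{\,s\in\mathcal{E}\mid \text{there exists } J\in\mathcal{J}(x,s)\text{ with }\operatorname{diag}(s,J)\in\Diamond f(\lambda(x))\,\},$$ where $\Diamond f(\lambda(x))$ denotes the subdifferential of $f$ at the point $\lambda(x)\in\mathbb{R}^r$.
   Context: Euclidean Jordan algebras. A Euclidean Jordan algebra $(\mathcal{E},\circ)$ is a finite-dimensional real vector space with a bilinear product $\circ$ and an inner product $\langle\cdot,\cdot\rangle$ such that $x\circ y=y\circ x$, $x\circ(x^2\circ y)=x^2\circ(x\circ y)$ (with $x^2=x\circ x$), and $\langle x\circ y,z\rangle=\langle x,y\circ z\rangle$; it has an identity element $e$. An idempotent is $c$ with $c\circ c=c$; a nonzero idempotent is primitive if it is not a sum of two nonzero idempotents $\hat c,\tilde c$ with $\hat c\circ\tilde c=0$. A Jordan frame is an ordered tuple $J=[c_1,\dots,c_r]$ of primitive idempotents with $c_i\circ c_j=0$ for $i\ne j$ and $c_1+\dots+c_r=e$; all Jordan frames have the same length $r$, the rank of $\mathcal{E}$. By the spectral theorem every $x$ is $\sum_i\alpha_ic_i$ for some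 Jordan frame (one then says $J$ diagonalizes $x$), with the real numbers $\alpha_i$ (the eigenvalues of $x$) unique up to order. $\lambda(x)=(\lambda_1(x),\dots,\lambda_r(x))$ is the vector of eigenvalues in nonincreasing order. $\operatorname{tr}(x)=\sum_i\lambda_i(x)$. The inner product is taken to be $\langle x,y\rangle=\operatorname{tr}(x\circ y)$, with norm $\|x\|=\sqrt{\operatorname{tr}(x^2)}$. $\mathbb{R}^r$ has the usual Euclidean inner product and norm. For a Jordan frame $J=[c_1,\dots,c_r]$, $\operatorname{diag}(z,J)=(\langle c_1,z\rangle,\dots,\langle c_r,z\rangle)\in\mathbb{R}^r$. $\mathcal{J}(x,s)$ is the set of Jordan frames $J$ that diagonalize both $x$ and $s$ and satisfy $\operatorname{diag}(x,J)=\lambda(x)$ (empty if $x$ and $s$ have no common diagonalizing Jordan frame). $f$ is symmetric if $f(Pu)=f(u)$ for all $u\in\mathbb{R}^r$ and all $r\times r$ permutation matrices $P$. Subdifferentials (on a finite-dimensional Euclidean space $V$, being $\mathbb{R}^r$ or $\mathcal{E}$). Let $g:V\to[-\infty,+\infty]$ and $\operatorname{dom} g=\{u\mid g(u)\in\mathbb{R}\}$. For $u\in\operatorname{dom} g$: - $d\in\hat\partial g(u)$ iff $\liminf_{v\to0,\,v\ne0}\frac{g(u+v)-g(u)-\langle d,v\rangle}{\|v\|}\ge0$. - $d\in\partial g(u)$ iff there are sequences $u^k\to u$, $d^k\to d$ with $g(u^k)\to g(u)$ and $d^k\in\hat\partial g(u^k)$ for all $k$. - $d\in\partial^\infty g(u)$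 iff there are sequences $u^k\to u$, $d^k\in\hat\partial g(u^k)$, and $t^k\downarrow0$ (all $t^k>0$, nonincreasing, converging to $0$) with $g(u^k)\to g(u)$ and $t^kd^k\to d$. For $u\notin\operatorname{dom} g$ these sets are taken to be empty. *)

(* Defs.v *)
From HB Require Import structures.
From mathcomp Require Import all_boot all_order all_algebra.
From mathcomp Require Import all_classical all_reals all_analysis.

Set Implicit Arguments.
Unset Strict Implicit.
Unset Printing Implicit Defensive.

Import Order.TTheory GRing.Theory Num.Theory.
Import numFieldNormedType.Exports.

Local Open Scope classical_set_scope.
Local Open Scope ring_scope.

(* Linearity in the second arguments follows from the two symmetry axioms. *)
HB.mixin Record isEuclideanJordan (R : realType) E of Vector R E := {
  jmul : E -> E -> E;
  jdot : E -> E -> R;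
  jone : E;
  jmul_linear : forall y, linear (jmul^~ y);
  jmulC : commutative jmul;
  jordan_identity : forall x y,
    jmul x (jmul (jmul x x) y) = jmul (jmul x x) (jmul x y);
  jmul1 : left_id jone jmul;
  jdot_scalar : forall y, scalar (jdot^~ y);
  jdotC : forall x y, jdot x y = jdot y x;
  jdot_gt0 : forall x, x != 0 -> 0 < jdot x x;
  jdot_assoc : forall x y z, jdot (jmul x y) z = jdot x (jmul y z) }.

#[short(type="ejaType")]
HB.structure Definition EuclideanJordan (R : realType) :=
  { E of isEuclideanJordan R E & Vector R E }.

Section EuclideanJordanAlgebra.
Variables (R : realType) (E : ejaType R).
Implicit Types (x s z c : E) (r : nat).

Definition idempotent_elt c := jmul c c = c.

Definition primitive_idempotent c :=
  [/\ c != 0, idempotent_elt c &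
      ~ exists c1 c2, [/\ c1 != 0, c2 != 0, idempotent_elt c1,
                          idempotent_elt c2 & jmul c1 c2 = 0 /\ c = c1 + c2]].

Definition jordan_frame r (J : 'I_r -> E) :=
  [/\ forall i, primitive_idempotent (J i),
      forall i j, i != j -> jmul (J i) (J j) = 0 &
      \sum_i J i = jone].

(* All Jordan frames of E have the same length, so the choice is forced. *)
Definition jrank : nat := xget 0%N [set r | exists J : 'I_r -> E, jordan_frame J].

(* "x is the sum of the a_i c_i", for the frame J = [c_1, ..., c_r]. *)
Definition diagonalizes_with (J : 'I_jrank -> E) x (a : 'cV[R]_jrank) :=
  x = \sum_i a i 0 *: J i.

Definition diagonalizes (J : 'I_jrank -> E) x := exists a, diagonalizes_with J x a.

(* By the spectral theorem the set below is a singleton. *)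
Definition lambda x : 'cV[R]_jrank :=
  xget 0 [set a : 'cV[R]_jrank |
    (forall i j : 'I_jrank, (i <= j)%N -> a j 0 <= a i 0) /\
    exists2 J, jordan_frame J & diagonalizes_with J x a].

Definition jtr x : R := \sum_i lambda x i 0.

Definition jdiag z (J : 'I_jrank -> E) : 'cV[R]_jrank := \col_i jdot (J i) z.

Definition common_frames x s : set ('I_jrank -> E) :=
  [set J | [/\ jordan_frame J, diagonalizes J x, diagonalizes J s &
               jdiag x J = lambda x]].

Definition spectral_function (f : 'cV[R]_jrank -> \bar R) : E -> \bar R :=
  fun x => f (lambda x).

End EuclideanJordanAlgebra.

Definition symmetric_function (R : realType) r (f : 'cV[R]_r -> \bar R) :=
  forall (P : 'M[R]_r) (u : 'cV[R]_r), is_perm_mx P -> f (P *m u) = f u.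

Definition euclid_dot (R : realType) r (u v : 'cV[R]_r) : R :=
  \sum_i u i 0 * v i 0.

(* The Euclidean space is the module V with the inner product dot; limits in V
   are taken for the norm of dot, not for any norm V may carry in the library
   (which on 'cV[R]_r is the sup norm). *)
Section Subdifferentials.
Variables (R : realType) (V : lmodType R) (dot : V -> V -> R).
Implicit Types (g : V -> \bar R) (u d v : V).

Definition dot_norm v : R := Num.sqrt (dot v v).

Definition dot_cvg (us : nat -> V) u :=
  dot_norm (us k - u) @[k --> \oo] --> (0 : R).

Definition liminf0 (q : V -> \bar R) : \bar R :=
  ereal_sup [set ereal_inf [set q v | v in [set v | v != 0 /\ dot_norm v < e]]
            | e in [set e : R | 0 < e]].

Definition edom g : set V := [set u | g u \is a fin_num].

Definition regular_subdiff g u : set V := [set d | edom g u /\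
  (0 <= liminf0 (fun v =>
     (g (u + v)%R - g u - (dot d v)%:E) * ((dot_norm v)^-1)%:E))%E].

Definition approximate_subdiff g u : set V := [set d | edom g u /\
  exists us ds : nat -> V,
    [/\ dot_cvg us u, dot_cvg ds d, g (us k) @[k --> \oo] --> g u &
        forall k, regular_subdiff g (us k) (ds k)]].

Definition horizon_subdiff g u : set V := [set d | edom g u /\
  exists (us ds : nat -> V) (t : nat -> R),
    [/\ dot_cvg us u,
        g (us k) @[k --> \oo] --> g u,
        forall k, regular_subdiff g (us k) (ds k),
        [/\ forall k, 0 < t k, nonincreasing_seq t &
            t k @[k --> \oo] --> (0 : R)] &
        dot_cvg (fun k => t k *: ds k) d]].

End Subdifferentials.

Inductive subdiff_kind := Regular | Approximate | Horizon.

Definition subdiff (R : realType) (V : lmodType R) (D : subdiff_kind) :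
    (V -> V -> R) -> (V -> \bar R) -> V -> set V :=
  match D with
  | Regular => @regular_subdiff R V
  | Approximate => @approximate_subdiff R V
  | Horizon => @horizon_subdiff R V
  end.

(* Main.v *)
(* The hypothesis that the inner product is the trace form drives the spectral
   theory: an element of nonzero trace is diagonalized by some frame, hence so
   are every nonzero idempotent and every nonzero square [x *o x]. The Jordan
   identity makes [x] block diagonal with respect to the eigenspaces of
   [x *o x], and on the block of an eigenvalue t > 0 it is sqrt t times a
   difference of two idempotents; this yields the spectral theorem.

   The inequality <x, y> <= <lambda x, lambda y> gives the uniqueness of
   eigenvalues and the Lipschitz continuity of lambda. If s is a regular
   subgradient of F at x, then F is constant along the rotations of two
   idempotents c_k, c_l of a frame of x with different eigenvalues, so s is
   orthogonal to the Peirce space E_kl; hence s is block diagonal with respect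
   to x and a common frame exists. Conversely, let d be a regular subgradient of
   f at lambda x, sorted inside the blocks of equal eigenvalues, and let s have
   diagonal d. For small eps > 0 the eigenvalues of x + eps s are
   lambda x + eps d, and the inequality above applied to x + eps s and x + z
   gives <d, lambda (x + z) - lambda x> >= <s, z> - |z|^2 / (2 eps).

   The approximate and horizon subdifferentials follow by passing to the limit,
   the set of Jordan frames being compact. *)
Require Import Defs.
From HB Require Import structures.
From mathcomp Require Import all_boot all_order all_algebra all_fingroup.
From mathcomp Require Import all_classical all_reals all_analysis.
From mathcomp Require Import ring lra.

Set Implicit Arguments.
Unset Strict Implicit.
Unset Printing Implicit Defensive.

Import Order.TTheory GRing.Theory Num.Theory.
Import numFieldNormedType.Exports.

Local Open Scope classical_set_scope.
Local Open Scope ring_scope.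

Local Infix "*o" := jmul (at level 40, left associativity).

(** * Peirce decomposition *)

Section Bilinear.
Variables (R : realType) (E : ejaType R).
Implicit Types (x y z c d : E) (a : R).

Lemma jmulDl y x z : (x + z) *o y = x *o y + z *o y.
Proof. by have := jmul_linear y 1 x z; rewrite !scale1r. Qed.

Lemma jmul0l y : 0 *o y = 0 :> E.
Proof.
have := jmulDl y 0 0; rewrite addr0 => h.
by apply: (addrI (0 *o y)); rewrite addr0 -h.
Qed.

Lemma jmulZl a x y : (a *: x) *o y = a *: (x *o y).
Proof. by have := jmul_linear y a x 0; rewrite jmul0l !addr0. Qed.

Lemma jmulDr y x z : y *o (x + z) = y *o x + y *o z.
Proof. by rewrite ![y *o _]jmulC jmulDl. Qed.

Lemma jmulZr a x y : x *o (a *: y) = a *: (x *o y).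
Proof. by rewrite ![x *o _]jmulC jmulZl. Qed.

Lemma jmul0r y : y *o 0 = 0 :> E.
Proof. by rewrite jmulC jmul0l. Qed.

Lemma jmulNl x y : (- x) *o y = - (x *o y).
Proof. by rewrite -scaleN1r jmulZl scaleN1r. Qed.

Lemma jmulNr x y : x *o (- y) = - (x *o y).
Proof. by rewrite -scaleN1r jmulZr scaleN1r. Qed.

Definition jmulE := (jmulDl, jmulDr, jmulNl, jmulNr, jmulZl, jmulZr).

Lemma jmul_suml I (s : seq I) (P : pred I) (F : I -> E) y :
  (\sum_(i <- s | P i) F i) *o y = \sum_(i <- s | P i) F i *o y.
Proof. exact: (big_morph (jmul^~ y) (jmulDl y) (jmul0l y)). Qed.

Lemma jmul_sumr I (s : seq I) (P : pred I) (F : I -> E) y :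
  y *o (\sum_(i <- s | P i) F i) = \sum_(i <- s | P i) y *o F i.
Proof. exact: (big_morph (jmul y) (jmulDr y) (jmul0r y)). Qed.

Lemma jdotDl y x z : jdot (x + z) y = jdot x y + jdot z y.
Proof. by have := jdot_scalar y 1 x z; rewrite scale1r mul1r. Qed.

Lemma jdot0l y : jdot 0 y = 0.
Proof.
have := jdotDl y 0 0; rewrite addr0 => h.
by apply: (addrI (jdot 0 y)); rewrite addr0 -h.
Qed.

Lemma jdotZl a x y : jdot (a *: x) y = a * jdot x y.
Proof. by have := jdot_scalar y a x 0; rewrite jdot0l !addr0. Qed.

Lemma jdotDr y x z : jdot y (x + z) = jdot y x + jdot y z.
Proof. by rewrite ![jdot y _]jdotC jdotDl. Qed.

Lemma jdotZr a x y : jdot x (a *: y) = a * jdot x y.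
Proof. by rewrite ![jdot x _]jdotC jdotZl. Qed.

Lemma jdot0r y : jdot y 0 = 0.
Proof. by rewrite jdotC jdot0l. Qed.

Lemma jdotNl x y : jdot (- x) y = - jdot x y.
Proof. by rewrite -scaleN1r jdotZl mulN1r. Qed.

Lemma jdotNr x y : jdot x (- y) = - jdot x y.
Proof. by rewrite -scaleN1r jdotZr mulN1r. Qed.

Lemma jdot_suml I (s : seq I) (P : pred I) (F : I -> E) y :
  jdot (\sum_(i <- s | P i) F i) y = \sum_(i <- s | P i) jdot (F i) y.
Proof. exact: (big_morph (jdot^~ y) (jdotDl y) (jdot0l y)). Qed.

Lemma jdot_sumr I (s : seq I) (P : pred I) (F : I -> E) y :
  jdot y (\sum_(i <- s | P i) F i) = \sum_(i <- s | P i) jdot y (F i).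
Proof. exact: (big_morph (jdot y) (jdotDr y) (jdot0r y)). Qed.

Definition jdotE :=
  (jdotDl, jdotDr, jdotNl, jdotNr, jdotZl, jdotZr, jdot0l, jdot0r).

Lemma jdot_ge0 x : 0 <= jdot x x.
Proof.
have [->|/jdot_gt0/ltW//] := eqVneq x 0.
by rewrite jdot0l.
Qed.

Lemma jdot_eq0 x : (jdot x x == 0) = (x == 0).
Proof.
have [->|/jdot_gt0] := eqVneq x 0; first by rewrite jdot0l eqxx.
by move/lt0r_neq0/negbTE.
Qed.

Lemma jdot_inj x y : (forall t, jdot x t = jdot y t) -> x = y.
Proof.
move=> h; apply/eqP; rewrite -subr_eq0 -jdot_eq0 jdotDl jdotNl h.
by rewrite subrr.
Qed.

Lemma jmul1r x : x *o jone = x.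
Proof. by rewrite jmulC jmul1. Qed.

End Bilinear.

(* Linear identities between vectors are checked on the scalar products with
   an arbitrary test vector. *)
Ltac test_vector t := apply: jdot_inj => t; rewrite ?jdotE.
Ltac test_vector_in H t :=
  let h := fresh in
  pose proof (congr1 (fun u => jdot u t) H) as h; rewrite ?jdotE in h.

Section Peirce.
Variables (R : realType) (E : ejaType R).
Implicit Types (x y z c d f p : E) (a : R).

(** This is the part of degree one in [y] of the Jordan identity at [x + y]: subtracting the
    identity at [x - y] removes the even degrees, and the identity at [y] removes degree three. *)
Lemma jordan_polarized x y z :
  y *o ((x *o x) *o z) + 2 *: (x *o ((x *o y) *o z)) =
  (x *o x) *o (y *o z) + 2 *: ((x *o y) *o (x *o z)).
Proof.
have hp := jordan_identity (x + y) z; have hm := jordan_identity (x - y) z.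
have hy := jordan_identity y z.
rewrite !jmulE ![y *o x]jmulC in hp hm.
test_vector t; test_vector_in hp t; test_vector_in hm t; test_vector_in hy t.
lra.
Qed.

(** With L the multiplication by [c], this reads L (2 L - 1) (L - 1) = 0: the Peirce eigenvalues are
    0, 1/2 and 1. *)
Lemma idempotent_cubic c y : idempotent_elt c ->
  2 *: (c *o (c *o (c *o y))) + c *o y = 3 *: (c *o (c *o y)).
Proof.
move=> cc; have := jordan_polarized c y c.
rewrite !cc [y *o c]jmulC ![(c *o y) *o c]jmulC => h.
test_vector t; test_vector_in h t; lra.
Qed.

Lemma orthogonal_comm c d y : idempotent_elt c -> c *o d = 0 ->
  c *o (d *o y) = d *o (c *o y).
Proof.
move=> cc cd; have := jordan_polarized c d y.
by rewrite cc cd !jmul0l jmul0r scaler0 !addr0 => ->.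
Qed.

(** The composite of the multiplications by two orthogonal idempotents takes its values in the
    Peirce 1/2-space of each. This is the polarized identity at ([c], [y], [d]), after commuting [c]
    and [d]. *)
Lemma orthogonal_half c d y : idempotent_elt c -> c *o d = 0 ->
  c *o (c *o (d *o y)) = 2^-1 *: (c *o (d *o y)).
Proof.
move=> cc cd; have h := jordan_polarized c y d.
rewrite cc cd [(c *o y) *o d]jmulC [y *o d]jmulC !jmul0r scaler0 addr0 add0r in
  h.
rewrite -(orthogonal_comm y cc cd) in h.
test_vector t; test_vector_in h t; lra.
Qed.

Lemma idempotentD c d : idempotent_elt c -> idempotent_elt d -> c *o d = 0 ->
  idempotent_elt (c + d).
Proof.
by move=> cc dd cd; rewrite /idempotent_elt !jmulE cc dd [d *o c]jmulC cd addr0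
  add0r.
Qed.

(** Apply [orthogonal_half] to the idempotent [c + d] and expand: the square terms cancel by the
    same lemma for [c] and for [d], which leaves the cross terms. *)
Lemma orthogonal_triple c d f y : idempotent_elt c -> idempotent_elt d ->
  c *o d = 0 -> c *o f = 0 -> d *o f = 0 -> c *o (d *o (f *o y)) = 0.
Proof.
move=> cc dd cd cf df.
have h := @orthogonal_half (c + d) f y (idempotentD cc dd cd).
rewrite jmulDl cf df addr0 in h; move: (h erefl); rewrite !jmulE !scalerDr.
rewrite !orthogonal_half // [d *o (c *o _)]jmulC.
rewrite [_ *o d]jmulC -(@orthogonal_comm c d) // => {}h.
test_vector t; test_vector_in h t; lra.
Qed.

Lemma peirce_comm c y z : idempotent_elt c -> c *o y = y \/ c *o y = 0 ->
  c *o (y *o z) = y *o (c *o z).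
Proof.
move=> cc cy; have h := jordan_polarized c y z; rewrite cc in h.
case: cy => cy; rewrite cy ?jmul0l ?jmul0r in h;
  test_vector t; test_vector_in h t; lra.
Qed.

Lemma peirce1_mul c y z : idempotent_elt c -> c *o y = y -> c *o z = z ->
  c *o (y *o z) = y *o z.
Proof. by move=> cc cy cz; rewrite peirce_comm ?cz //; left. Qed.

(** Multiplication by [c] commutes with that by [y] and with that by [z], so the product lies both
    in the Peirce 0-space and in the Peirce 1-space of [c]. *)
Lemma peirce10_mul c y z : idempotent_elt c -> c *o y = y -> c *o z = 0 ->
  y *o z = 0.
Proof.
move=> cc cy cz; have h : c *o (y *o z) = 0.
  by rewrite peirce_comm ?cz ?jmul0r //; left.
rewrite [y *o z]jmulC peirce_comm ?cy in h; [|by []|by right].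
by rewrite jmulC h.
Qed.

(* That is, [y *o y] lies in the sum of the Peirce spaces 0 and 1 of [c]. *)
Lemma peirce_half_sqr c y : idempotent_elt c -> c *o y = 2^-1 *: y ->
  c *o (c *o (y *o y)) = c *o (y *o y).
Proof.
move=> cc cy; have h := jordan_polarized y c c.
rewrite !cc ![y *o c]jmulC cy !jmulE in h.
rewrite [y *o c]jmulC cy !jmulE [(y *o y) *o c]jmulC in h.
test_vector t; test_vector_in h t; lra.
Qed.

(* Modulo the cubic relation 2 L^3 - 3 L^2 + L = 0 satisfied by the
   multiplication L by [c], L = L^2 + 4 (L^2 - L)^2. *)
Lemma jmul_idempotent_ge0 c y : idempotent_elt c -> 0 <= jdot (c *o y) y.
Proof.
move=> cc; have h2 := idempotent_cubic y cc.
have := jdot_ge0 (c *o y).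
have := jdot_ge0 (c *o (c *o y) - c *o y).
have := congr1 (jdot^~ y) h2; rewrite /= !jdotE.
set t1 := c *o y; set t2 := c *o t1; set t3 := c *o t2.
have e1 u v : jdot (c *o u) v = jdot u (c *o v) by rewrite jmulC jdot_assoc.
have := congr1 (jdot^~ t1) h2; rewrite /= !jdotE -/t1 -/t2 -/t3.
have -> : jdot t2 t2 = jdot t3 t1 by rewrite {1}/t2 /t3 !e1.
have -> : jdot t1 t1 = jdot t2 y by rewrite {1}/t2 e1 jdotC -/t1.
have -> : jdot t2 t1 = jdot t3 y by rewrite /t3 e1.
have -> : jdot t1 t2 = jdot t3 y by rewrite jdotC /t3 e1.
lra.
Qed.

Lemma idempotent_dot_ge0 c d : idempotent_elt c -> idempotent_elt d ->
  0 <= jdot c d.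
Proof.
move=> cc dd; have -> : jdot c d = jdot (c *o d) d by rewrite jdot_assoc dd.
exact: jmul_idempotent_ge0.
Qed.

(** The hypothesis says that [z] has no Peirce 1/2-component; its 1- and 0-components multiply to
    zero, so squaring respects the splitting. *)
Lemma peirce_sqr c z : idempotent_elt c -> c *o (c *o z) = c *o z ->
  c *o (z *o z) = (c *o z) *o (c *o z).
Proof.
move=> cc ccz; set u := c *o z in ccz *; set v := z - u.
have cv : c *o v = 0 by rewrite jmulDr jmulNr ccz subrr.
have uv : u *o v = 0 by exact: peirce10_mul ccz cv.
have -> : z = u + v by rewrite addrC subrK.
clearbody u v.
rewrite !jmulE [v *o u]jmulC uv jmul0r (peirce1_mul cc ccz ccz).
by rewrite (peirce_comm _ cc (or_intror cv)) cv jmul0r !addr0.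
Qed.

Lemma jdot_one c : idempotent_elt c -> jdot c jone = jdot c c.
Proof. by move=> cc; rewrite -{1}cc jdot_assoc jmul1r. Qed.

End Peirce.

(** * Spectral theorem *)

Section OrthogonalFamilies.
Variables (R : realType) (E : ejaType R) (n : nat).
Implicit Types (J : 'I_n -> E) (a b : 'I_n -> R) (x y z : E) (t u : R).

Definition complete_orthogonal J :=
  [/\ forall i, idempotent_elt (J i), forall i j, i != j -> J i *o J j = 0 &
      \sum_i J i = jone].

Lemma jordan_frame_complete J : jordan_frame J -> complete_orthogonal J.
Proof. by case=> hp ho h1; split=> // i; have [] := hp i. Qed.

Variable J : 'I_n -> E.
Hypothesis frameJ : complete_orthogonal J.

Lemma complete_mul a j : (\sum_i a i *: J i) *o J j = a j *: J j.
Proof.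
have [hi ho _] := frameJ; rewrite jmul_suml (bigD1 j) //= jmulZl hi.
by rewrite big1 ?addr0// => i /ho h; rewrite jmulZl h scaler0.
Qed.

Lemma complete_dot i j : i != j -> jdot (J i) (J j) = 0.
Proof.
have [hi ho _] := frameJ => /ho h.
by rewrite -[J i]hi jdot_assoc h jdot0r.
Qed.

Lemma complete_dot_coef a i :
  jdot (J i) (\sum_j a j *: J j) = a i * jdot (J i) (J i).
Proof.
rewrite jdot_sumr (bigD1 i) //= jdotZr big1 ?addr0// => j ji.
by rewrite jdotZr complete_dot ?mulr0// eq_sym.
Qed.

Lemma complete_comm a l z :
  (\sum_i a i *: J i) *o (J l *o z) = J l *o ((\sum_i a i *: J i) *o z).
Proof.
have [hi ho _] := frameJ; rewrite !jmul_suml jmul_sumr; apply: eq_bigr => i _.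
rewrite !jmulE; congr (_ *: _); have [->//|il] := eqVneq i l.
by rewrite orthogonal_comm// ho.
Qed.

(** [J l *o (J k *o z)] lies in the 1/2-spaces of [J k] and [J l], and every other [J i] kills it;
    hence the eigenvalue is the mean of [a k] and [a l]. *)
Lemma complete_peirce a k l z : k != l ->
  (\sum_i a i *: J i) *o (J l *o (J k *o z)) =
  ((a k + a l) / 2) *: (J l *o (J k *o z)).
Proof.
have [hi ho _] := frameJ => kl; have lk : l != k by rewrite eq_sym.
rewrite jmul_suml (bigD1 k) //= (bigD1 l) //= big1 => [|i /andP[ik il]].
  rewrite addr0 !jmulZl orthogonal_half ?ho//.
  rewrite [J l *o (J k *o z)]orthogonal_comm ?ho// orthogonal_half ?ho//.
  by rewrite !scalerA -scalerDl -mulrDl.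
by rewrite jmulZl orthogonal_triple ?scaler0 ?ho.
Qed.

(* The vectors whose Peirce components between different eigenspaces of
   [\sum_i a i *: J i] vanish. *)
Definition block_diagonal a z :=
  forall k l, a k != a l -> J l *o (J k *o z) = 0.

(** Apply [J l] to the hypothesis: on the Peirce component between [k] and [l], one side acts as
    [a k] and the other as the mean of [a k] and [a l]. *)
Lemma block_diagonal_comm a z (y := \sum_i a i *: J i) :
  (forall k, z *o (y *o J k) = y *o (z *o J k)) -> block_diagonal a z.
Proof.
move=> hc k l akl; have kl : k != l by apply: contraNneq akl => ->.
have := hc k; rewrite complete_mul jmulZr => /(congr1 (jmul (J l))).
rewrite [z *o J k]jmulC jmulZr -complete_comm complete_peirce// => h.
have : ((a k - a l) / 2) *: (J l *o (J k *o z)) = 0.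
  test_vector t; test_vector_in h t; lra.
move/eqP; rewrite scaler_eq0 => /orP[|/eqP//].
by rewrite mulf_eq0 invr_eq0 pnatr_eq0 orbF subr_eq0 (negbTE akl).
Qed.

Definition eigen_idempotent a t := \sum_(k | a k == t) J k.

Definition eigenvalues a := undup (codom a).

Lemma eigen_idempotent_orth a t u : t != u ->
  eigen_idempotent a t *o eigen_idempotent a u = 0.
Proof.
have [hi ho _] := frameJ => tu.
rewrite jmul_suml big1// => k /eqP ak; rewrite jmul_sumr big1// => l /eqP al.
by apply: ho; apply: contraNneq tu => kl; rewrite -ak -al kl.
Qed.

Lemma eigen_idempotentP a t : idempotent_elt (eigen_idempotent a t).
Proof.
have [hi ho _] := frameJ; rewrite /idempotent_elt {1}/eigen_idempotent.
rewrite jmul_suml; apply: eq_bigr => k ak; rewrite jmul_sumr (bigD1 k)//= hi.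
by rewrite big1 ?addr0// => l /andP[_ lk]; rewrite ho// eq_sym.
Qed.

Lemma eigen_sum (V : nmodType) a (F : R -> 'I_n -> V) :
  \sum_(t <- eigenvalues a) \sum_(k | a k == t) F t k = \sum_k F (a k) k.
Proof.
rewrite (exchange_big_dep xpredT)//=; apply: eq_bigr => k _.
rewrite -big_filter (_ : [seq _ <- _ | _] = [:: a k]) ?big_seq1//.
rewrite (@eq_filter _ _ (pred1 (a k))) => [|t]; last by rewrite /= eq_sym.
by apply: filter_pred1_uniq; rewrite ?undup_uniq// mem_undup codom_f.
Qed.

Lemma eigen_idempotent_sum a :
  \sum_(t <- eigenvalues a) eigen_idempotent a t = jone.
Proof. by rewrite (eigen_sum a (fun _ => J)); case: frameJ. Qed.

Lemma eigen_idempotent_resolution a :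
  \sum_(t <- eigenvalues a) t *: eigen_idempotent a t = \sum_i a i *: J i.
Proof.
rewrite -(eigen_sum a (fun t k => t *: J k)).
by apply: eq_bigr => t _; rewrite scaler_sumr.
Qed.

Lemma eigen_idempotent_mul a t :
  eigen_idempotent a t *o (\sum_i a i *: J i) = t *: eigen_idempotent a t.
Proof.
rewrite jmulC jmul_sumr scaler_sumr; apply: eq_bigr => k /eqP <-.
exact: complete_mul.
Qed.

Lemma block_diagonal_orth a z t u : block_diagonal a z -> t != u ->
  eigen_idempotent a t *o (eigen_idempotent a u *o z) = 0.
Proof.
move=> bz tu; rewrite jmul_suml big1// => k /eqP ak.
rewrite jmul_suml jmul_sumr big1// => l /eqP al.
by rewrite bz// ak al eq_sym.
Qed.

Lemma block_diagonal_sum a z :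
  z = \sum_(t <- eigenvalues a) eigen_idempotent a t *o z.
Proof. by rewrite -jmul_suml eigen_idempotent_sum jmul1. Qed.

Lemma block_diagonal_block a z t : block_diagonal a z ->
  eigen_idempotent a t *o (eigen_idempotent a t *o z) = eigen_idempotent a t *o
    z.
Proof.
move=> bz; have [ta|ta] := boolP (t \in eigenvalues a); last first.
  rewrite /eigen_idempotent big1 ?jmul0l// => k /eqP ak.
  by move: ta; rewrite mem_undup -ak codom_f.
rewrite {2}(block_diagonal_sum a z) jmul_sumr.
rewrite (bigD1_seq t) ?undup_uniq//= big1 ?addr0// => u ut.
by rewrite block_diagonal_orth// eq_sym.
Qed.

Lemma block_diagonal_mul0 a z t u : block_diagonal a z -> t != u ->
  (eigen_idempotent a t *o z) *o (eigen_idempotent a u *o z) = 0.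
Proof.
move=> bz tu; apply: (peirce10_mul (eigen_idempotentP a t)).
  exact: block_diagonal_block.
exact: block_diagonal_orth.
Qed.

End OrthogonalFamilies.

(** * Resolutions of an idempotent into orthogonal primitive idempotents *)

Section Resolutions.
Variables (R : realType) (E : ejaType R).
Implicit Types (x y z s c d p q : E) (S : seq (R * R * E)).

(* [S] lists orthogonal primitive idempotents [c] with sum [p], each with its
   coefficients in [x] and in [s]. *)
Definition resolution p x s S :=
  [/\ forall u, u \in S -> primitive_idempotent u.2,
      pairwise (fun u v => u.2 *o v.2 == 0) S,
      \sum_(u <- S) u.2 = p, \sum_(u <- S) u.1.1 *: u.2 = x &
      \sum_(u <- S) u.1.2 *: u.2 = s].

Definition resolvable p x s := exists S, resolution p x s S.

Lemma resolution_mul p x s S u : resolution p x s S -> u \in S ->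
  p *o u.2 = u.2.
Proof.
move=> [hp ho <- _ _] uS; rewrite jmul_suml.
elim: S hp ho uS => //= v S IH hp /andP[/allP vS ho].
have hp' w : w \in S -> primitive_idempotent w.2.
  by move=> wS; apply: hp; rewrite inE wS orbT.
rewrite inE big_cons => /orP[/eqP ->|uS].
  have [_ hv _] := hp v (mem_head _ _); rewrite hv big1_seq ?addr0// => w.
  by move=> /andP[_ wS]; have /eqP := vS _ wS; rewrite jmulC.
by rewrite IH//; have /eqP -> := vS _ uS; rewrite add0r.
Qed.

Lemma resolution_idempotent p x s S : resolution p x s S -> idempotent_elt p.
Proof.
move=> rS; have [_ _ hs _ _] := rS.
rewrite /idempotent_elt -{2 3}hs jmul_sumr; apply: eq_big_seq => u.
exact: (resolution_mul rS).
Qed.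

Lemma resolvable0 : resolvable 0 0 0.
Proof. by exists [::]; split; rewrite ?big_nil. Qed.

Lemma resolvableD p q x y s z : p *o q = 0 ->
  resolvable p x s -> resolvable q y z -> resolvable (p + q) (x + y) (s + z).
Proof.
move=> pq [S rS] [T rT]; exists (S ++ T).
have pp := resolution_idempotent rS; have qq := resolution_idempotent rT.
have [hp ho hs hx hy] := rS; have [hp' ho' hs' hx' hy'] := rT.
split; rewrite ?big_cat/= ?hs ?hx ?hy ?hs' ?hx' ?hy'//.
  by move=> u; rewrite mem_cat => /orP[/hp|/hp'].
rewrite pairwise_cat ho ho' !andbT; apply/allrelP => u v uS vT.
apply/eqP; apply: (peirce10_mul pp (resolution_mul rS uS)).
rewrite jmulC; apply: (peirce10_mul qq (resolution_mul rT vT)).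
by rewrite jmulC.
Qed.

Lemma resolvable_sum (T : eqType) (r : seq T) (p x s : T -> E) : uniq r ->
  (forall t u, t != u -> p t *o p u = 0) ->
  (forall t, t \in r -> resolvable (p t) (x t) (s t)) ->
  resolvable (\sum_(t <- r) p t) (\sum_(t <- r) x t) (\sum_(t <- r) s t).
Proof.
move=> + po; elim: r => [|t r IH] /=.
  by rewrite !big_nil => *; exact: resolvable0.
move=> /andP[tr ur] hr; rewrite !big_cons; apply: resolvableD.
- rewrite jmul_sumr big1_seq// => u /andP[_ ur']; apply: po.
  by apply: contraNneq tr => ->.
- by apply: hr; rewrite mem_head.
- by apply: IH => // u ur'; apply: hr; rewrite inE ur' orbT.
Qed.

Lemma resolvable_scale p x s a : resolvable p x s -> resolvable p (a *: p) s.
Proof.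
move=> [S [hp ho hs hx hy]]; exists [seq ((a, u.1.2), u.2) | u <- S].
split; rewrite ?big_map//=; last by rewrite -scaler_sumr hs.
- by move=> _ /mapP[u uS ->] /=; exact: hp.
- by rewrite pairwise_map.
Qed.

End Resolutions.

(** * Primitive idempotents and frames under the trace form *)

Section TraceForm.
Variables (R : realType) (E : ejaType R).
Hypothesis trace_dot : forall x y : E, jdot x y = jtr (jmul x y).
Implicit Types (x y z s c d p q : E) (S : seq (R * R * E)).
Local Notation r := (jrank E).

(* When no frame diagonalizes [x], [lambda x] is the default value 0. *)
Lemma trace_dot_frame x : jtr x != 0 ->
  exists2 J : 'I_r -> E, jordan_frame J & diagonalizes_with J x (lambda x).
Proof.
rewrite /jtr /lambda; case: xgetP => [a _ [_ //]|_].
by rewrite big1 ?eqxx// => i _; rewrite mxE.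
Qed.

Lemma frame_neq0 n (J : 'I_n -> E) i : jordan_frame J -> J i != 0.
Proof. by case=> /(_ i)[]. Qed.

(** The trace of [c] is its squared norm, hence positive, so some frame diagonalizes [c]; the
    equation [c *o c = c] forces the coefficients to be 0 or 1. *)
Lemma idempotent_frame c : c != 0 -> idempotent_elt c ->
  exists (J : 'I_r -> E) (A : {set 'I_r}),
    [/\ jordan_frame J, c = \sum_(i in A) J i & jdot c c = #|A|%:R].
Proof.
move=> c0 cc; have := jdot_gt0 _ c0; rewrite trace_dot cc => tr_gt0.
have [J fJ dc] := trace_dot_frame (lt0r_neq0 tr_gt0).
have cJ := jordan_frame_complete fJ; set a := lambda c in dc.
have hJ i : c *o J i = a i 0 *: J i by rewrite dc (complete_mul cJ).
have sqr_c : c = \sum_i (a i 0 * a i 0) *: J i.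
  rewrite -{1}cc {2}dc jmul_sumr; apply: eq_bigr => i _.
  by rewrite jmulZr hJ scalerA.
have a01 i : a i 0 = (a i 0 == 1)%:R.
  have cJi : c *o J i = (a i 0 * a i 0) *: J i.
    by rewrite {1}sqr_c (complete_mul cJ).
  have /eqP : (a i 0 * a i 0 - a i 0) *: J i = 0.
    by rewrite scalerBl -cJi hJ subrr.
  rewrite scaler_eq0 (negbTE (frame_neq0 i fJ)) orbF => /eqP e.
  have /eqP : a i 0 * (a i 0 - 1) = 0 by rewrite mulrBr mulr1.
  rewrite mulf_eq0 subr_eq0 => /orP[/eqP ->|/eqP ->]; rewrite ?eqxx//.
  by rewrite eq_sym oner_eq0.
exists J, [set i | a i 0 == 1]%SET; split=> //.
  rewrite {1}dc [RHS]big_mkcond/=; apply: eq_bigr => i _; rewrite inE a01.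
  by case: eqP => _; rewrite ?eqxx ?scale1r// eq_sym oner_eq0 scale0r.
rewrite /jtr -/a -sum1_card natr_sum [RHS]big_mkcond/=; apply: eq_bigr => i _.
by rewrite inE {1}a01; case: eqP.
Qed.

Lemma idempotent_norm_ge1 c : c != 0 -> idempotent_elt c -> 1 <= jdot c c.
Proof.
move=> c0 cc; have [J [A [fJ dc ->]]] := idempotent_frame c0 cc.
rewrite ler1n card_gt0; apply: contra_neq c0 => A0.
by rewrite dc A0 big_set0.
Qed.

(** The squared norm of an idempotent counts the frame elements it is made of, and it adds up over
    orthogonal summands. This form of primitivity is also a closed condition, which the limits of
    frames require. *)
Lemma primitiveP c :
  primitive_idempotent c <-> idempotent_elt c /\ jdot c c = 1.
Proof.
split=> [[c0 cc irr]|[cc c1]]; last first.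
  have c0 : c != 0 by rewrite -jdot_eq0 c1 oner_eq0.
  split=> // -[d [e [d0 e0 dd ee [de]]]] dce.
  have := idempotent_norm_ge1 d0 dd; have := idempotent_norm_ge1 e0 ee.
  have ded : jdot d e = 0 by rewrite -[d]dd jdot_assoc de jdot0r.
  move: c1; rewrite dce !jdotE [jdot e d]jdotC ded; lra.
split=> //; have [J [A [fJ dc ->]]] := idempotent_frame c0 cc.
have [hi ho _] := jordan_frame_complete fJ.
have /set0Pn[i iA] : A != finset.set0.
  by apply: contra_neq c0 => A0; rewrite dc A0 big_set0.
rewrite (cardsD1 i) iA; have [->|/set0Pn[j jA]] :=
  eqVneq (A :\ i)%SET finset.set0.
  by rewrite cards0.
case: irr; exists (J i), (\sum_(k in (A :\ i)%SET) J k).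
have sumi k : k != i -> J i *o J k = 0 by move=> ki; rewrite ho// eq_sym.
have orth : J i *o (\sum_(k in (A :\ i)%SET) J k) = 0.
  by rewrite jmul_sumr big1// => k; rewrite !inE => /andP[ki _]; rewrite sumi.
have sum_mul k : k \in (A :\ i)%SET ->
  (\sum_(k in (A :\ i)%SET) J k) *o J k = J k.
  move=> kA; rewrite jmul_suml (bigD1 k)//= hi big1 ?addr0// => l /andP[_ lk].
  by rewrite ho.
have ids : idempotent_elt (\sum_(k in (A :\ i)%SET) J k).
  by rewrite /idempotent_elt jmul_sumr; apply: eq_bigr => k /sum_mul.
split=> //; first exact: frame_neq0.
  apply: contra_neq (frame_neq0 j fJ) => s0.
  by rewrite -(sum_mul j jA) s0 jmul0l.
split=> //; rewrite {1}dc (bigD1 i)//=; congr (_ + _).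
by apply: eq_bigl => k; rewrite !inE andbC.
Qed.

Lemma frame_dot1 n (J : 'I_n -> E) i : jordan_frame J -> jdot (J i) (J i) = 1.
Proof. by case=> /(_ i)/primitiveP[]. Qed.

Lemma jdot11 n (J : 'I_n -> E) : jordan_frame J -> jdot (jone : E) jone = n%:R.
Proof.
move=> fJ; have [hi ho h1] := jordan_frame_complete fJ.
rewrite -{1}h1 jdot_suml.
under eq_bigr do rewrite jdot_one// (frame_dot1 _ fJ).
by rewrite sumr_const card_ord.
Qed.

Lemma exists_frame : exists J : 'I_r -> E, jordan_frame J.
Proof.
have [e0|e0] := eqVneq (jone : E) 0; last first.
  have [|J [A [fJ _ _]]] := @idempotent_frame jone e0; last by exists J.
  exact: jmul1.
(* If the identity is 0, the empty family is a frame, so [jrank] selects a length for which a frame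
   exists. *)
have : exists n, exists J : 'I_n -> E, jordan_frame J.
  exists 0%N, (fun _ => 0); split; try by case.
  by rewrite big_ord0 e0.
by move=> frames; exact: (xgetPex 0%N frames).
Qed.

Lemma resolution_size p x s S : resolution p x s S ->
  (size S)%:R = jdot p p.
Proof.
move=> rS; have [hp _ hs _ _] := rS.
rewrite -(jdot_one (resolution_idempotent rS)) -{}hs jdot_suml big_seq.
under eq_bigr => u uS.
  have [uu u1] := (primitiveP _).1 (hp u uS); rewrite jdot_one// u1; over.
by rewrite -big_seq -sum1_size natr_sum.
Qed.

Lemma resolvable_idempotent p a b : idempotent_elt p ->
  resolvable p (a *: p) (b *: p).
Proof.
move=> pp; have [->|p0] := eqVneq p 0; first by rewrite !scaler0;
  exact: resolvable0.
have [J [A [fJ dp _]]] := idempotent_frame p0 pp.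
have [hi ho _] := jordan_frame_complete fJ; have [hp _ _] := fJ.
exists [seq ((a, b), J i) | i <- enum A].
split; rewrite ?big_map -?scaler_sumr ?big_enum -?dp//.
  by move=> _ /mapP[i _ ->] /=; exact: hp.
rewrite pairwise_map; apply: (@sub_pairwise _ [rel i j : 'I_r | i != j]) =>
  [i j /=|].
  by move=> /ho ->.
by rewrite -uniq_pairwise enum_uniq.
Qed.

(** Sort the list by the coefficients of [x]. Its length is the squared norm of the identity, which
    any frame of length [r] shows to be [r]. *)
Lemma resolvable_frame x s : resolvable jone x s ->
  exists (J : 'I_r -> E) (a b : 'cV[R]_r),
    [/\ jordan_frame J, forall i j : 'I_r, (i <= j)%N -> a j 0 <= a i 0,
        diagonalizes_with J x a & diagonalizes_with J s b].
Proof.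
move=> [S0 rS0]; have [hp0 ho0 hs0 hx0 hy0] := rS0.
pose ord := [rel u v : R * R * E | v.1.1 <= u.1.1].
have ord_total : total ord by move=> u v; exact: le_total.
have ord_trans : transitive ord by move=> u v w /= h1 h2; exact: le_trans h1.
pose S := sort ord S0; have pS : perm_eq S S0 by rewrite perm_sort.
have hp u : u \in S -> primitive_idempotent u.2 by rewrite mem_sort; exact: hp0.
have irr u : u \in S0 -> u.2 *o u.2 != 0.
  by move=> /hp0[u0 uu _]; rewrite uu.
have uS : uniq S.
  rewrite sort_uniq uniq_pairwise;
    apply: (@sub_in_pairwise _ (mem S0)) _ _ ho0 => [u v uS vS /= uv|];
      last exact/allP.
  by apply: contraTneq uv => <-; exact: irr.
have ho u v : u \in S -> v \in S -> u != v -> u.2 *o v.2 = 0.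
  rewrite !mem_sort => uS0 vS0 uv.
  (* [pairwise] compares an entry with later ones only; this reflexive and symmetric weakening
     extends to all pairs of entries. *)
  pose orth (u v : R * R * E) := (u == v) || (u.2 *o v.2 == 0).
  have orthr : reflexive orth by move=> w; rewrite /orth eqxx.
  have orths : symmetric orth by move=> w w'; rewrite /orth eq_sym jmulC.
  have : pairwise orth S0.
    by apply: sub_pairwise ho0 => w w' ww'; rewrite /orth ww' orbT.
  rewrite pairwise_all2rel// => /allrelP/(_ _ _ uS0 vS0).
  by rewrite /orth (negbTE uv) => /eqP.
have z : R * R * E := (0, 0, 0).
have szS : size S = r.
  have [J fJ] := exists_frame; rewrite size_sort.
  by apply/eqP; rewrite -(eqr_nat R) -(jdot11 fJ) (resolution_size rS0).
pose J (i : 'I_r) := (nth z S i).2.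
have sumS (F : R * R * E -> E) :
  \sum_(i < r) F (nth z S i) = \sum_(u <- S0) F u.
  by rewrite -(perm_big _ pS) /= (big_nth z) szS big_mkord.
exists J, (\col_i (nth z S i).1.1), (\col_i (nth z S i).1.2); split.
- split=> [i|i j ij|].
  + by apply: hp; rewrite mem_nth// szS.
  + by apply: ho; rewrite ?mem_nth ?nth_uniq ?szS.
  + by rewrite sumS.
- move=> i j ij; rewrite !mxE.
  have : sorted ord S by exact: sort_sorted.
  move=> /(sorted_leq_nth ord_trans (fun u => lexx _)) h.
  by apply: h; rewrite ?inE ?szS.
- by rewrite /diagonalizes_with; under eq_bigr do rewrite mxE;
    rewrite (sumS (fun u => u.1.1 *: u.2)).
- by rewrite /diagonalizes_with; under eq_bigr do rewrite mxE;
    rewrite (sumS (fun u => u.1.2 *: u.2)).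
Qed.

End TraceForm.

(** * Diagonalization of an element and of a commuting pair *)

Section SpectralTheorem.
Variables (R : realType) (E : ejaType R).
Hypothesis trace_dot : forall x y : E, jdot x y = jtr (jmul x y).
Implicit Types (x y z s c d p q : E).
Local Notation r := (jrank E).

Lemma resolvable_sqrt c w t : idempotent_elt c -> c *o w = w ->
  w *o w = t *: c -> resolvable c w w.
Proof.
move=> cc cw ww; have [t0|t_gt0] := leP t 0.
  (* Here <w, w> = <c, w^2> = t <c, c>, so a nonpositive [t] forces [w = 0]. *)
  have : jdot w w <= 0.
    rewrite -[in X in jdot X]cw jdot_assoc ww jdotZr.
    by rewrite mulr_le0_ge0// jdot_ge0.
  move=> w0; have -> : w = 0.
    by apply/eqP; rewrite -jdot_eq0 eq_le w0 jdot_ge0.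
  by rewrite -(scale0r c); exact: resolvable_idempotent.
pose a := Num.sqrt t; have a_neq0 : a != 0 by rewrite gt_eqF ?sqrtr_gt0.
have aa : a * a = t by rewrite -expr2 sqr_sqrtr// ltW.
pose v := a^-1 *: w; have wE : w = a *: v by rewrite scalerA divff ?scale1r.
have vv : v *o v = c.
  by rewrite !jmulE ww !scalerA -aa mulrACA !mulrA mulVf// mul1r mulVf//
    scale1r.
have cv : c *o v = v by rewrite jmulZr cw.
have vc : v *o c = v by rewrite jmulC.
clearbody v; rewrite {cw ww}wE.
(* Since v^2 = c, these are orthogonal idempotents with sum [c] and difference [v]. *)
pose p := 2^-1 *: (c + v); pose q := 2^-1 *: (c - v).
have pp : idempotent_elt p.
  by rewrite /idempotent_elt /p !jmulE cc vv cv vc; test_vector t'; field.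
have qq : idempotent_elt q.
  by rewrite /idempotent_elt /q !jmulE cc vv cv vc; test_vector t'; field.
have pq : p *o q = 0.
  by rewrite /p /q !jmulE cc vv cv vc; test_vector t'; field.
have -> : a *: v = a *: p + - a *: q by test_vector t'; field.
have -> : c = p + q by test_vector t'; field.
by apply: resolvableD => //; exact: resolvable_idempotent.
Qed.

(* The square of [x] has positive trace, and the Jordan identity makes [x] block
   diagonal with respect to it. *)
Lemma exists_diagonalization x :
  exists (J : 'I_r -> E) a, jordan_frame J /\ diagonalizes_with J x a.
Proof.
have [->|x0] := eqVneq x 0.
  have [J fJ] := exists_frame trace_dot; exists J, 0; split=> //.
  by rewrite /diagonalizes_with big1// => i _; rewrite mxE scale0r.
have [|J fJ] := trace_dot_frame (x := x *o x).
  by rewrite -trace_dot lt0r_neq0// jdot_gt0.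
rewrite /diagonalizes_with; set b := fun i => lambda (x *o x) i 0.
move=> dx; have cJ := jordan_frame_complete fJ.
have bx : block_diagonal J b x.
  by apply: (block_diagonal_comm cJ) => k; rewrite -dx jordan_identity.
suff : resolvable jone x x.
  by move=> /(resolvable_frame trace_dot)[K [a [_ [fK _ dxa _]]]]; exists K, a.
rewrite -(eigen_idempotent_sum cJ b) (block_diagonal_sum cJ b x).
apply: resolvable_sum => [|t u|t _]; first exact: undup_uniq.
  exact: eigen_idempotent_orth.
apply: (@resolvable_sqrt _ _ t); first exact: eigen_idempotentP.
  exact: block_diagonal_block.
rewrite -peirce_sqr; [|exact: eigen_idempotentP|exact: block_diagonal_block].
rewrite dx; exact: eigen_idempotent_mul.
Qed.

(** A frame diagonalizing [y] need not refine [p]. But multiplication by [y] commutes with that by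
    [p], so [p] is block diagonal; its blocks are orthogonal idempotents with sum [p], and on each
    of them [y] is a scalar. *)
Lemma resolvable_peirce1 p y : idempotent_elt p -> p *o y = y ->
  resolvable p y y.
Proof.
move=> pp py; have [J [a' [fJ]]] := exists_diagonalization y.
rewrite /diagonalizes_with; set a := fun i => a' i 0 => dy.
have cJ := jordan_frame_complete fJ.
have bp : block_diagonal J a p.
  by apply: (block_diagonal_comm cJ) => k; rewrite -dy peirce_comm//; left.
have dp := block_diagonal_sum cJ a p.
have dy' : y = \sum_(t <- eigenvalues a) t *: (eigen_idempotent J a t *o p).
  rewrite -[LHS]py jmulC {1}dp jmul_sumr; apply: eq_bigr => t _.
  rewrite [_ *o p]jmulC -peirce_comm//; last by left.
  by rewrite [y *o _]jmulC dy eigen_idempotent_mul// jmulZr.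
rewrite dy' {1}dp; apply: resolvable_sum => [|t u tu|t _].
- exact: undup_uniq.
- exact: block_diagonal_mul0.
- apply: resolvable_idempotent => //; rewrite /idempotent_elt -peirce_sqr ?pp//.
    exact: eigen_idempotentP.
  exact: block_diagonal_block.
Qed.

(** In each block [x] is a multiple of the eigen-idempotent, so any resolution of the block of [s]
    serves for [x] as well. *)
Lemma common_resolution x s (J : 'I_r -> E) a : complete_orthogonal J ->
  x = \sum_i a i *: J i -> block_diagonal J a s -> resolvable jone x s.
Proof.
move=> cJ dx bs; rewrite dx -(eigen_idempotent_sum cJ a).
rewrite -eigen_idempotent_resolution// (block_diagonal_sum cJ a s).
apply: resolvable_sum => [|t u|t _]; first exact: undup_uniq.
  exact: eigen_idempotent_orth.
apply: resolvable_scale; apply: resolvable_peirce1;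
  first exact: eigen_idempotentP.
exact: block_diagonal_block.
Qed.

(** A resolution of [c] has <c, c> = 1 element, so [y] has a single coefficient. *)
Lemma peirce1_primitive c y : primitive_idempotent c -> c *o y = y ->
  exists a, y = a *: c.
Proof.
move=> pc cy; have /(primitiveP trace_dot)[cc c1] := pc.
have [S rS] := resolvable_peirce1 cc cy; have [hp ho hs hx _] := rS.
have := resolution_size trace_dot rS; rewrite c1.
move/eqP; rewrite pnatr_eq1; case: S {rS} hp ho hs hx => [|u []]//= _ _.
by rewrite !big_seq1 => <- <- _; exists u.1.1.
Qed.

End SpectralTheorem.

(** * Eigenvalues *)

Section Fan.
Variables (R : realType).

(* Dual potentials of the assignment problem with gains [a i * b j]: the
   identity permutation is optimal. *)
Lemma fan_potential (a b : nat -> R) n :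
  (forall i j, (i <= j < n)%N -> a j <= a i) ->
  (forall i j, (i <= j < n)%N -> b j <= b i) ->
  exists u v : nat -> R,
    [/\ forall i j, (i < n)%N -> (j < n)%N -> a i * b j <= u i + v j &
        forall i, a i * b i = u i + v i].
Proof.
move=> sa sb; pose u k := \sum_(0 <= m < k) b m * (a m.+1 - a m).
exists u, (fun k => a k * b k - u k); split=> [i j ni nj|i];
  last by rewrite addrC subrK.
have tel k l : (k <= l)%N -> a l - a k = \sum_(k <= m < l) (a m.+1 - a m).
  by move=> kl; rewrite telescope_sumr.
(* Both sides are sums of the decrements of [a] between the two indices, weighted by [b j] on the
   left and by [b m] on the right; the monotonicity of [b] compares them. *)
suff : (a i - a j) * b j <= u i - u j by lra.
case: (leqP j i) => [ji|/ltnW ij].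
  have -> : u i - u j = \sum_(j <= m < i) b m * (a m.+1 - a m).
    by rewrite /u (big_cat_nat (leq0n j) ji)/=; ring.
  rewrite tel// mulr_suml !big_seq; apply: ler_sum => m;
    rewrite mem_index_iota => /andP[jm mi].
  rewrite mulrC ler_wnM2r ?subr_le0 ?sa ?sb ?leqnSn ?jm//=.
    by apply: leq_trans ni.
  by apply: ltn_trans ni.
have uE : u j - u i = \sum_(i <= m < j) b m * (a m.+1 - a m).
  by rewrite /u (big_cat_nat (leq0n i) ij)/=; ring.
suff : u j - u i <= (a j - a i) * b j by lra.
rewrite uE tel// mulr_suml !big_seq; apply: ler_sum => m;
  rewrite mem_index_iota => /andP[im mj].
rewrite mulrC [leRHS]mulrC mulrC ler_wnM2r ?subr_le0 ?sa ?sb ?leqnSn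
  ?(ltnW mj)//=.
by apply: leq_ltn_trans nj.
Qed.

(** Weak duality: the bound [u i + v j] integrates against [M] to a quantity that depends only on
    the row and column sums, so it may be computed on the diagonal. *)
Lemma doubly_stochastic_le n (a b : 'I_n -> R) (M : 'I_n -> 'I_n -> R) :
  (forall i j : 'I_n, (i <= j)%N -> a j <= a i) ->
  (forall i j : 'I_n, (i <= j)%N -> b j <= b i) ->
  (forall i j, 0 <= M i j) -> (forall i, \sum_j M i j = 1) ->
  (forall j, \sum_i M i j = 1) ->
  \sum_i \sum_j a i * b j * M i j <= \sum_i a i * b i.
Proof.
(* The empty case is separated because [inord] needs a nonempty index type. *)
case: n a b M => [|n] a b M sa sb M0 M1 M2; first by rewrite !big_ord0.
have [||u [v [huv huv']]] := @fan_potential (a \o inord) (b \o inord) n.+1.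
- by move=> i j /andP[ij jn]; apply: sa; rewrite !inordK//;
    exact: leq_ltn_trans jn.
- by move=> i j /andP[ij jn]; apply: sb; rewrite !inordK//;
    exact: leq_ltn_trans jn.
have -> : \sum_i a i * b i =
    \sum_(i < n.+1) \sum_(j < n.+1) (u i + v j) * M i j.
  under [RHS]eq_bigr do (under eq_bigr do rewrite mulrDl; rewrite big_split/=).
  rewrite big_split/= [X in _ + X]exchange_big/= -big_split/=.
  apply: eq_bigr => i _; rewrite -!mulr_sumr M1 M2 !mulr1.
  by rewrite -huv'/= inord_val.
apply: ler_sum => i _; apply: ler_sum => j _; apply: ler_wpM2r => //.
by have := huv i j (ltn_ord i) (ltn_ord j); rewrite /= !inord_val.
Qed.

End Fan.

Lemma sort_perm (T : Type) (leT : rel T) n (k : 'I_n -> T) :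
  total leT -> transitive leT ->
  exists sg : 'S_n, forall i j : 'I_n, (i <= j)%N -> leT (k (sg i)) (k (sg j)).
Proof.
move=> tot tr; pose ord := relpre k leT.
pose s := sort ord (enum 'I_n).
have szs : size s = n by rewrite size_sort size_enum_ord.
have us : uniq s by rewrite sort_uniq enum_uniq.
have inj : injective (fun i : 'I_n => nth i s i).
  move=> i j; rewrite (set_nth_default j) ?szs// => /eqP.
  by rewrite nth_uniq ?szs// => /eqP/val_inj.
have ordtr : transitive ord by move=> x y z; exact: tr.
have ss : sorted ord s by apply: sort_sorted => x y; exact: tot.
exists (perm inj) => i j ij; rewrite !permE (set_nth_default i j) ?szs//.
have rf : reflexive ord by move=> x; have := tot (k x) (k x); rewrite orbb.
by apply: (sorted_leq_nth ordtr rf i ss); rewrite ?inE ?szs.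
Qed.

Section EuclideanDot.
Variables (R : realType) (n : nat).
Implicit Types (u v w : 'cV[R]_n).

Lemma euclid_dotC u v : euclid_dot u v = euclid_dot v u.
Proof. by apply: eq_bigr => i _; rewrite mulrC. Qed.

Lemma euclid_dotDl u v w :
  euclid_dot (u + v) w = euclid_dot u w + euclid_dot v w.
Proof. by rewrite -big_split; apply: eq_bigr => i _; rewrite mxE mulrDl. Qed.

Lemma euclid_dotZl a u w : euclid_dot (a *: u) w = a * euclid_dot u w.
Proof. by rewrite mulr_sumr; apply: eq_bigr => i _; rewrite mxE mulrA. Qed.

Lemma euclid_dotNl u w : euclid_dot (- u) w = - euclid_dot u w.
Proof. by rewrite -scaleN1r euclid_dotZl mulN1r. Qed.

Lemma euclid_dotDr u v w :
  euclid_dot w (u + v) = euclid_dot w u + euclid_dot w v.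
Proof. by rewrite ![euclid_dot w _]euclid_dotC euclid_dotDl. Qed.

Lemma euclid_dotZr a u w : euclid_dot w (a *: u) = a * euclid_dot w u.
Proof. by rewrite ![euclid_dot w _]euclid_dotC euclid_dotZl. Qed.

Lemma euclid_dotNr u w : euclid_dot w (- u) = - euclid_dot w u.
Proof. by rewrite ![euclid_dot w _]euclid_dotC euclid_dotNl. Qed.

Lemma euclid_dot_ge0 u : 0 <= euclid_dot u u.
Proof. by apply: sumr_ge0 => i _; rewrite -expr2 sqr_ge0. Qed.

Lemma euclid_dot_eq0 u : (euclid_dot u u == 0) = (u == 0).
Proof.
have sq i : true -> 0 <= u i 0 * u i 0 by rewrite -expr2 sqr_ge0.
rewrite /euclid_dot psumr_eq0//.
apply/allP/eqP => [h|-> i _]; last by rewrite /= mxE mulr0.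
apply/colP => i; have := h i (mem_index_enum i).
by rewrite mulf_eq0 orbb mxE => /eqP.
Qed.

Definition euclid_dotE := (euclid_dotDl, euclid_dotDr, euclid_dotNl,
  euclid_dotNr, euclid_dotZl, euclid_dotZr).

Definition permc (sg : 'S_n) u : 'cV[R]_n := \col_i u (sg i) 0.

Lemma permc_dot sg u v : euclid_dot (permc sg u) (permc sg v) = euclid_dot u v.
Proof.
rewrite /euclid_dot [RHS](reindex_inj (@perm_inj _ sg)); apply: eq_bigr => i _.
by rewrite !mxE.
Qed.

Lemma permcD sg u v : permc sg (u + v) = permc sg u + permc sg v.
Proof. by apply/colP => i; rewrite !mxE. Qed.

Lemma permc_permV sg u : permc sg (permc (sg^-1)%g u) = u.
Proof. by apply/colP => i; rewrite !mxE permK. Qed.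

Lemma symmetric_permc (f : 'cV[R]_n -> \bar R) sg u : symmetric_function f ->
  f (permc sg u) = f u.
Proof.
move=> fs; rewrite -(fs _ u (perm_mx_is_perm R sg)); congr f.
by apply/colP => i; rewrite -row_permE !mxE.
Qed.

End EuclideanDot.

Section Eigenvalues.
Variables (R : realType) (E : ejaType R).
Hypothesis trace_dot : forall x y : E, jdot x y = jtr (jmul x y).
Implicit Types (x y z s c d p q : E).
Local Notation r := (jrank E).
Implicit Types (J : 'I_r -> E) (a b u v : 'cV[R]_r).

Definition nonincreasing_col a :=
  forall i j : 'I_r, (i <= j)%N -> a j 0 <= a i 0.

Definition frame_sum J a : E := \sum_i a i 0 *: J i.

Lemma frame_sumD J a b : frame_sum J (a + b) = frame_sum J a + frame_sum J b.
Proof.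
by rewrite /frame_sum -big_split; apply: eq_bigr => i _; rewrite mxE scalerDl.
Qed.

Lemma frame_sumZ J k b : frame_sum J (k *: b) = k *: frame_sum J b.
Proof. by rewrite scaler_sumr; apply: eq_bigr => i _; rewrite mxE scalerA. Qed.

Lemma jdot_frame_sum J a x : jdot (frame_sum J a) x = euclid_dot a (jdiag x J).
Proof.
by rewrite jdot_suml; apply: eq_bigr => i _; rewrite jdotZl mxE.
Qed.

Lemma jdiag_frame_sum J a : jordan_frame J -> jdiag (frame_sum J a) J = a.
Proof.
move=> fJ; apply/colP => i; rewrite mxE.
rewrite (complete_dot_coef (jordan_frame_complete fJ) (fun i => a i 0)).
by rewrite frame_dot1// mulr1.
Qed.

Lemma frame_sum_dot J a b : jordan_frame J ->
  jdot (frame_sum J a) (frame_sum J b) = euclid_dot a b.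
Proof. by move=> fJ; rewrite jdot_frame_sum jdiag_frame_sum. Qed.

(** The matrix of the products <J i, K j> is doubly stochastic: idempotents have nonnegative
    products, and each frame sums to the identity. *)
Lemma frame_sum_dot_le J K a b : jordan_frame J -> jordan_frame K ->
  nonincreasing_col a -> nonincreasing_col b ->
  jdot (frame_sum J a) (frame_sum K b) <= euclid_dot a b.
Proof.
move=> fJ fK sa sb.
have [hJ _ J1] := jordan_frame_complete fJ;
  have [hK _ K1] := jordan_frame_complete fK.
have := @doubly_stochastic_le R r (fun i => a i 0) (fun i => b i 0)
  (fun i j => jdot (J i) (K j)) sa sb.
move=> le_ab; apply: le_trans (le_ab _ _ _).
- rewrite jdot_suml ler_sum// => i _; rewrite jdot_sumr ler_sum// => j _.
  by rewrite jdotZl jdotZr mulrA.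
- by move=> i j; exact: idempotent_dot_ge0.
- by move=> i; rewrite -jdot_sumr K1 jdot_one// frame_dot1.
- by move=> j; rewrite -jdot_suml J1 jdotC jdot_one// frame_dot1.
Qed.

Lemma jordan_frame_perm J (sg : 'S_r) : jordan_frame J ->
  jordan_frame (J \o sg).
Proof.
case=> hp ho h1; split=> /= [i|i j ij|]; first exact: hp.
  by apply: ho; rewrite (inj_eq perm_inj).
by rewrite -h1 [RHS](reindex_inj (@perm_inj _ sg)).
Qed.

Lemma frame_sum_perm J (sg : 'S_r) a :
  frame_sum (J \o sg) (permc sg a) = frame_sum J a.
Proof.
rewrite /frame_sum [RHS](reindex_inj (@perm_inj _ sg)).
by apply: eq_bigr => i _; rewrite mxE.
Qed.

Lemma lambdaP x : nonincreasing_col (lambda x) /\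
  exists2 J, jordan_frame J & x = frame_sum J (lambda x).
Proof.
apply: (xgetPex 0 (P := [set a : 'cV[R]_r | nonincreasing_col a /\
  exists2 J, jordan_frame J & diagonalizes_with J x a])).
have [J [a [fJ dx]]] := exists_diagonalization trace_dot x.
have geR_total : total (>=%R : rel R) by move=> ? ?; exact: le_total.
have geR_trans : transitive (>=%R : rel R) by move=> ? ? ? /= h1 h2;
  exact: le_trans h1.
have [sg hsg] := sort_perm (fun i => a i 0) geR_total geR_trans.
exists (permc sg a); split=> [i j ij|]; first by rewrite !mxE; exact: hsg.
exists (J \o sg); first exact: jordan_frame_perm.
by rewrite /diagonalizes_with -[RHS]/(frame_sum _ _) frame_sum_perm.
Qed.

Lemma lambda_dot_le x y : jdot x y <= euclid_dot (lambda x) (lambda y).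
Proof.
have [sx [J fJ {1}->]] := lambdaP x; have [sy [K fK {1}->]] := lambdaP y.
exact: frame_sum_dot_le.
Qed.

Lemma lambda_dot x : euclid_dot (lambda x) (lambda x) = jdot x x.
Proof. by have [_ [J fJ {3 4}->]] := lambdaP x; rewrite frame_sum_dot. Qed.

(* [frame_sum_dot_le] bounds [|lambda x - a|^2] by 0. *)
Lemma lambda_unique J a : jordan_frame J -> nonincreasing_col a ->
  lambda (frame_sum J a) = a.
Proof.
move=> fJ sa; set x := frame_sum J a; have [sx [K fK xK]] := lambdaP x.
apply/eqP; rewrite -subr_eq0 -euclid_dot_eq0 eq_le euclid_dot_ge0 andbT.
have := frame_sum_dot_le fK fJ sx sa; rewrite -xK -/x.
have := lambda_dot x; have := frame_sum_dot a a fJ; rewrite -/x.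
rewrite !euclid_dotE [euclid_dot a (lambda x)]euclid_dotC; lra.
Qed.

(** The order on pairs lets [b] break the ties among equal eigenvalues, as needed to sort a
    subgradient inside the blocks. *)
Lemma lambda_sort J a (leT : rel (R * R)) b : jordan_frame J -> total leT ->
  transitive leT -> (forall v w : R * R, leT v w -> w.1 <= v.1) ->
  exists sg, lambda (frame_sum J a) = permc sg a /\
   forall i j : 'I_r, (i <= j)%N ->
     leT (a (sg i) 0, b (sg i) 0) (a (sg j) 0, b (sg j) 0).
Proof.
move=> fJ tot tr le1; have [sg hsg] :=
  sort_perm (fun i => (a i 0, b i 0)) tot tr.
exists sg; split=> //; rewrite -(frame_sum_perm _ sg) lambda_unique//.
  exact: jordan_frame_perm.
by move=> i j /hsg/le1; rewrite !mxE.
Qed.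

Lemma lambda_perm J a : jordan_frame J ->
  exists sg, lambda (frame_sum J a) = permc sg a.
Proof.
move=> fJ; have [||//|sg [hsg _]] :=
  @lambda_sort J a [rel v w : R * R | w.1 <= v.1] a fJ.
- by move=> u v; exact: le_total.
- by move=> u v w /= h1 h2; exact: le_trans h1.
by exists sg.
Qed.

Lemma spectral_frame_sum f J a : symmetric_function f -> jordan_frame J ->
  spectral_function f (frame_sum J a) = f a.
Proof.
move=> fs fJ; rewrite /spectral_function.
by have [sg ->] := lambda_perm a fJ; rewrite symmetric_permc.
Qed.

(** Both squared distances expand with the same square terms by [lambda_dot]; the cross terms
    compare by [lambda_dot_le]. *)
Lemma lambda_lipschitz x y :
  euclid_dot (lambda x - lambda y) (lambda x - lambda y) <=
  jdot (x - y) (x - y).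
Proof.
have := lambda_dot_le x y; have := lambda_dot x; have := lambda_dot y.
rewrite !euclid_dotE !jdotE [euclid_dot (lambda y) (lambda x)]euclid_dotC.
by rewrite [jdot y x]jdotC; lra.
Qed.

End Eigenvalues.

(** * Regular subdifferential *)

Section RegularSubdifferential.
Variables (R : realType) (V : lmodType R) (dot : V -> V -> R).
Hypothesis dot0 : forall d, dot d 0 = 0.
Hypothesis dot_gt0 : forall v, v != 0 -> 0 < dot v v.
Implicit Types (g : V -> \bar R) (u d v : V).

Lemma dot_norm0 : dot_norm dot 0 = 0.
Proof. by rewrite /dot_norm dot0 sqrtr0. Qed.

Lemma liminf0_ge0 (q : V -> \bar R) :
  (0 <= liminf0 dot q)%E <->
  forall e, 0 < e -> exists2 k, 0 < k &
    forall v, v != 0 -> dot_norm dot v < k -> ((- e)%:E <= q v)%E.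
Proof.
split=> [h e e0|h].
  have : ((- e)%:E < liminf0 dot q)%E.
    by apply: lt_le_trans h; rewrite lte_fin oppr_lt0.
  move=> /ereal_sup_gt[_ [k k0 <-] lt_e]; exists k => // v v0 vk.
  by apply/ltW/(lt_le_trans lt_e)/ereal_inf_lbound; exists v.
apply/lee_addgt0Pr => e e0; rewrite -leeBlDr// sub0e.
have [k k0 hk] := h e e0.
apply: le_trans (ereal_sup_ubound _); last by exists k.
by apply/ereal_infP => _ [v [v0 vk] <-]; exact: hk.
Qed.

(** Without the quotient, infinite values of [g (u + v)] need no separate treatment, and the
    inequality holds trivially at [v = 0]. *)
Lemma regular_subdiffP g u d :
  regular_subdiff dot g u d <->
  g u \is a fin_num /\ forall e, 0 < e -> exists2 k, 0 < k &
    forall v, dot_norm dot v < k ->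
      (g u + (dot d v - e * dot_norm dot v)%:E <= g (u + v)%R)%E.
Proof.
rewrite /regular_subdiff /= /edom /= liminf0_ge0.
have norm_gt0 v : v != 0 -> 0 < dot_norm dot v by move=> /dot_gt0;
  rewrite sqrtr_gt0.
suff quotient v e : v != 0 -> g u \is a fin_num ->
    ((- e)%:E <=
       (g (u + v)%R - g u - (dot d v)%:E) * ((dot_norm dot v)^-1)%:E)%E =
    (g u + (dot d v - e * dot_norm dot v)%:E <= g (u + v)%R)%E.
  split=> -[gu h]; split=> // e /h[k k0 hk]; exists k => // v.
    have [->|v0 vk] := eqVneq v 0; last by rewrite -quotient//; exact: hk.
    by rewrite dot0 dot_norm0 mulr0 subr0 !(addr0, adde0).
  by move=> v0 vk; rewrite quotient//; exact: hk.
move=> /norm_gt0; set m := dot_norm dot v => m0 /fineK <-.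
case: (g (u + v)) => [b| |].
- rewrite -!EFinB -EFinM -EFinD !lee_fin ler_pdivlMr//.
  by apply/idP/idP; lra.
- by rewrite !addye// mulyr gtr0_sg ?invr_gt0// mul1e !leey.
- by rewrite !addNye mulNyr gtr0_sg ?invr_gt0// mul1e -EFinD !leeNy_eq.
Qed.

End RegularSubdifferential.

(** Along the norm-preserving map [L] the defining inequality transfers verbatim, [d'] being the
    pullback of the functional [d]. It is used for coordinate permutations and for the embedding
    [frame_sum J]. *)
Lemma regular_subdiff_pullback (R : realType) (V W : lmodType R)
    (dotV : V -> V -> R) (dotW : W -> W -> R) (L : W -> V)
    (g : V -> \bar R) (h : W -> \bar R) u d u' d' :
  (forall d, dotV d 0 = 0) -> (forall v, v != 0 -> 0 < dotV v v) ->
  (forall d, dotW d 0 = 0) -> (forall v, v != 0 -> 0 < dotW v v) ->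
  (forall v, dotV (L v) (L v) = dotW v v) ->
  (forall v, dotV d (L v) = dotW d' v) ->
  g u = h u' -> (forall v, g (u + L v) = h (u' + v)) ->
  regular_subdiff dotV g u d -> regular_subdiff dotW h u' d'.
Proof.
move=> V0 Vgt0 W0 Wgt0 LL dL guh gL /(regular_subdiffP V0 Vgt0)[gu hg].
apply/regular_subdiffP => //; rewrite -guh; split=> // e /hg[k k0 hk].
exists k => // v; rewrite -gL -dL.
have -> : dot_norm dotW v = dot_norm dotV (L v) by rewrite /dot_norm LL.
exact: hk.
Qed.

Section EuclideanRegular.
Variables (R : realType) (n : nat) (f : 'cV[R]_n -> \bar R).

Lemma euclid_dot0 (d : 'cV[R]_n) : euclid_dot d 0 = 0.
Proof. by rewrite -(scale0r 0) euclid_dotZr mul0r. Qed.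

Lemma euclid_dot_gt0 (v : 'cV[R]_n) : v != 0 -> 0 < euclid_dot v v.
Proof. by move=> v0; rewrite lt0r euclid_dot_eq0 v0 euclid_dot_ge0. Qed.

Lemma regular_subdiff_permc sg u d : symmetric_function f ->
  regular_subdiff (@euclid_dot R n) f u d ->
  regular_subdiff (@euclid_dot R n) f (permc sg u) (permc sg d).
Proof.
move=> fs; apply: (@regular_subdiff_pullback _ _ _ _ _ (permc (sg^-1)%g)).
- exact: euclid_dot0.
- exact: euclid_dot_gt0.
- exact: euclid_dot0.
- exact: euclid_dot_gt0.
- by move=> v; rewrite permc_dot.
- by move=> v; rewrite -(permc_dot sg) permc_permV.
- by rewrite symmetric_permc.
- by move=> v; rewrite -(symmetric_permc sg _ fs) permcD permc_permV.
Qed.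

End EuclideanRegular.

Section RegularSpectral.
Variables (R : realType) (E : ejaType R).
Hypothesis trace_dot : forall x y : E, jdot x y = jtr (jmul x y).
Local Notation r := (jrank E).
Variable f : 'cV[R]_r -> \bar R.
Hypothesis f_sym : symmetric_function f.
Implicit Types (x y z s c d p q : E) (J : 'I_r -> E) (a b u v : 'cV[R]_r).

Lemma regular_spectral_restrict x s J : common_frames x s J ->
  regular_subdiff jdot (spectral_function f) x s ->
  regular_subdiff (@euclid_dot R r) f (lambda x) (jdiag s J).
Proof.
move=> [fJ [a dx] _ dl].
have {}dx : x = frame_sum J (lambda x).
  by rewrite -dl [x in jdiag x]dx -/(frame_sum J a) jdiag_frame_sum.
apply: (@regular_subdiff_pullback _ _ _ _ _ (frame_sum J)).
- exact: jdot0r.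
- exact: jdot_gt0.
- exact: euclid_dot0.
- exact: euclid_dot_gt0.
- by move=> v; rewrite frame_sum_dot.
- by move=> v; rewrite jdotC jdot_frame_sum euclid_dotC.
- by [].
- by move=> v; rewrite {1}dx -frame_sumD spectral_frame_sum.
Qed.

Lemma small_step u (d : 'cV[R]_r) :
  (forall i j : 'I_r, (i <= j)%N ->
     (u j 0 < u i 0) || ((u i 0 == u j 0) && (d j 0 <= d i 0))) ->
  exists2 e, 0 < e & nonincreasing_col (u + e *: d).
Proof.
move=> ud.
(* Each strict gap of [u] is divided by a bound on the speed at which [d] can close it; the summand
   1 keeps the denominator positive. *)
pose e := \big[Num.min/1]_(p : 'I_r * 'I_r | u p.2 0 < u p.1 0)
  ((u p.1 0 - u p.2 0) / (1 + `|d p.2 0 - d p.1 0|)).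
have e0 : 0 < e.
  by apply: lt_bigmin => // p lt_u; rewrite divr_gt0 ?subr_gt0// ltr_pwDl.
exists e => // i j ij; rewrite !mxE.
have /orP[lt_u|/andP[/eqP -> led]] := ud i j ij; last first.
  by rewrite lerD2l ler_pM2l.
have /= : e <= (u i 0 - u j 0) / (1 + `|d j 0 - d i 0|).
  exact: (@bigmin_le_cond _ _ _ _ (i, j)).
rewrite ler_pdivlMr ?ltr_pwDl//.
have := ler_norm (d j 0 - d i 0); set m := `|_| => dm le_e.
have : e * (d j 0 - d i 0) <= e * (1 + m) by rewrite ler_pM2l//; lra.
lra.
Qed.

(* Sorting first by [u] and then by [d], one may assume that [u + eps *: d] is
   nonincreasing for small [eps > 0]; compare the frame sums of this vector with
   [x + z]. *)
Lemma regular_spectral_extend J u (d : 'cV[R]_r) : jordan_frame J ->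
  regular_subdiff (@euclid_dot R r) f u d ->
  regular_subdiff jdot (spectral_function f) (frame_sum J u) (frame_sum J d).
Proof.
move=> fJ ud.
pose leT := [rel v w : R * R | (w.1 < v.1) || ((v.1 == w.1) && (w.2 <= v.2))].
have [|||sg [lx hsg]] := lambda_sort trace_dot (leT := leT) u d fJ.
- move=> [v v'] [w w'] /=; case: ltgtP => //= _; exact: le_total.
- move=> [v v'] [w w'] [z z'] /= /orP[h1|/andP[/eqP -> h1]].
    by case/orP=> [h2|/andP[/eqP <- _]]; rewrite ?h1// (lt_trans h2).
  by case/orP=> [->//|/andP[-> h2]]; rewrite (le_trans h2) ?orbT.
- by move=> [v v'] [w w'] /=; case: ltgtP.
rewrite -(frame_sum_perm J sg u) -(frame_sum_perm J sg d).
rewrite -(frame_sum_perm J sg u) in lx.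
have : jordan_frame (J \o sg) by exact: jordan_frame_perm.
have : regular_subdiff (@euclid_dot R r) f (permc sg u) (permc sg d).
  exact: regular_subdiff_permc.
have [] := @small_step (permc sg u) (permc sg d).
  by move=> i j ij; rewrite !mxE; exact: hsg.
clear ud fJ hsg; move: {J}(J \o sg) {u}(permc sg u) {d}(permc sg d) lx =>
  J u d lx eps eps0 su.
move=> /(regular_subdiffP (@euclid_dot0 _ _) (@euclid_dot_gt0 _ _))[fu hf] fJ.
apply/(regular_subdiffP (@jdot0r _ _) (@jdot_gt0 _ _)).
rewrite {1 2}/spectral_function lx; split=> // e e0.
(* One half of [e] pays for the error of [f] at the increment of the eigenvalues, the other for
   |z|^2 / (2 eps), which is at most (e / 2) |z| once |z| <= e eps. *)
have [k k0 hk] := hf (e / 2) ltac:(by rewrite divr_gt0).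
exists (Num.min k (e * eps)); first by rewrite lt_min k0 mulr_gt0.
move=> z; rewrite lt_min => /andP[zk ze].
set x := frame_sum J u in lx *; set s := frame_sum J d.
pose D := lambda (x + z) - u.
have DE : lambda (x + z) = u + D by rewrite /D [RHS]addrC subrK.
have lipD : euclid_dot D D <= jdot z z.
  have := lambda_lipschitz trace_dot (x + z) x.
  by rewrite lx -/D [x + z]addrC addrK.
have nD : dot_norm (@euclid_dot R r) D <= dot_norm jdot z by exact: ler_wsqrtr.
rewrite /spectral_function DE; clearbody D.
apply: le_trans (hk D (le_lt_trans nD zk)); apply: leeD => //.
rewrite lee_fin.
have zz : jdot z z = dot_norm jdot z * dot_norm jdot z.
  by rewrite -expr2 sqr_sqrtr// jdot_ge0.
have sxz : jdot s x = euclid_dot d u by rewrite frame_sum_dot.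
have xx : jdot x x = euclid_dot u u by rewrite frame_sum_dot.
have ly : lambda (x + eps *: s) = u + eps *: d.
  by rewrite -frame_sumZ -frame_sumD lambda_unique.
(* The inequality leaves the term <u, D> - <x, z>; as |x + z| = |u + D| and |x| = |u|, it equals
   (|z|^2 - |D|^2) / 2. *)
have := lambda_dot_le trace_dot (x + eps *: s) (x + z).
have := lambda_dot trace_dot (x + z).
rewrite ly DE !jdotE !euclid_dotE sxz xx [euclid_dot D u]euclid_dotC.
rewrite [jdot z x]jdotC => e1 e2.
have D0 := euclid_dot_ge0 D.
have nz0 : 0 <= dot_norm jdot z by exact: sqrtr_ge0.
have e3 : eps * jdot s z <= eps * euclid_dot d D + jdot z z / 2 by lra.
have e4 : jdot z z <= (e * eps) * dot_norm jdot z.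
  by rewrite zz ler_wpM2r// ltW.
have : eps * jdot s z <= eps * (euclid_dot d D + e / 2 * dot_norm jdot z).
  by lra.
rewrite ler_pM2l// => e5.
have : e / 2 * dot_norm (@euclid_dot R r) D <= e / 2 * dot_norm jdot z.
  by rewrite ler_pM2l ?divr_gt0.
lra.
Qed.

End RegularSpectral.

(** * Rotations of a frame in a Peirce space *)

Section RotatedFrames.
Variables (R : realType) (E : ejaType R).
Hypothesis trace_dot : forall x y : E, jdot x y = jtr (jmul x y).
Implicit Types (x y z s c d w : E).

Lemma half_dot0 c w : idempotent_elt c -> c *o w = 2^-1 *: w -> jdot c w = 0.
Proof.
move=> cc cw; have : jdot c w = 2^-1 * jdot c w.
  by rewrite -{1}cc jdot_assoc cw jdotZr.
lra.
Qed.

(* For [p = cos t] and [q = sin t], [J k] and [J l] are rotated by the angle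
   [2 t] in the spin factor spanned by [J k], [J l] and [w]. *)
Definition rotate n (J : 'I_n -> E) k l w p q i :=
  if i == k then (p * p) *: J k + (p * q) *: w + (q * q) *: J l
  else if i == l then (q * q) *: J k + (- (p * q)) *: w + (p * p) *: J l
  else J i.

(** The span of [J k], [w] and [J l] is closed under the product, so the relations between the two
    new elements are identities between coefficients. Both lie in the Peirce 1-space of [J k + J l],
    hence are orthogonal to the rest of the frame. *)
Lemma rotate_frame n (J : 'I_n -> E) k l w p q : jordan_frame J -> k != l ->
  J k *o w = 2^-1 *: w -> J l *o w = 2^-1 *: w -> w *o w = J k + J l ->
  p * p + q * q = 1 -> jordan_frame (rotate J k l w p q).
Proof.
move=> fJ kl kw lw ww pq; have [hi ho h1] := jordan_frame_complete fJ.
set c := J k in kw ww *; set d := J l in lw ww *.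
have cc : c *o c = c := hi k; have dd : d *o d = d := hi l.
have cd : c *o d = 0 := ho k l kl; have dc : d *o c = 0 by rewrite jmulC.
have wc : w *o c = 2^-1 *: w by rewrite jmulC.
have wd : w *o d = 2^-1 *: w by rewrite jmulC.
pose C := (p * p) *: c + (p * q) *: w + (q * q) *: d.
pose D := (q * q) *: c + (- (p * q)) *: w + (p * p) *: d.
have pp : p * p = 1 - q * q by lra.
have cw0 : jdot c w = 0 by exact: half_dot0.
have dw0 : jdot d w = 0 by exact: half_dot0.
have c1 : jdot c c = 1 by exact: frame_dot1.
have d1 : jdot d d = 1 by exact: frame_dot1.
have cd0 : jdot c d = 0 by rewrite -cc jdot_assoc cd jdot0r.
have w2 : jdot w w = 2.
  rewrite -[X in jdot X w]jmul1 jdot_assoc ww jdotDr ![jdot jone _]jdotC.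
  by rewrite (jdot_one cc) (jdot_one dd) c1 d1.
have mulE a1 b1 e1 a2 b2 e2 :
  (a1 *: c + b1 *: w + e1 *: d) *o (a2 *: c + b2 *: w + e2 *: d) =
    (a1 * a2 + b1 * b2) *: c
    + ((a1 * b2 + b1 * a2 + b1 * e2 + e1 * b2) / 2) *: w
    + (b1 * b2 + e1 * e2) *: d.
  by rewrite !jmulE cc dd cd dc kw lw wc wd ww; test_vector t; field.
have dotE a1 b1 e1 a2 b2 e2 :
  jdot (a1 *: c + b1 *: w + e1 *: d) (a2 *: c + b2 *: w + e2 *: d) =
    a1 * a2 + 2 * (b1 * b2) + e1 * e2.
  by rewrite !jdotE [jdot w c]jdotC [jdot w d]jdotC [jdot d c]jdotC
             cw0 dw0 c1 d1 cd0 w2; ring.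
have S2 : (p * q) * (p * q) = (1 - q * q) * (q * q) by rewrite -pp; ring.
have CC : C *o C = C.
  by rewrite /C mulE S2 pp; congr (_ *: _ + _ *: _ + _ *: _); field.
have DD : D *o D = D.
  by rewrite /D mulE mulrNN S2 pp; congr (_ *: _ + _ *: _ + _ *: _); field.
have CD : C *o D = 0.
  rewrite /C /D mulE mulrN S2 pp [X in X *: c](_ : _ = 0); last by ring.
  rewrite [X in X *: w](_ : _ = 0); last by field.
  by rewrite [X in X *: d](_ : _ = 0) ?scale0r ?addr0//; ring.
have cdE : c + d = 1 *: c + 0 *: w + 1 *: d by rewrite !scale1r scale0r addr0.
have pC : (c + d) *o C = C.
  by rewrite cdE mulE; congr (_ *: _ + _ *: _ + _ *: _); field.
have pD : (c + d) *o D = D.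
  by rewrite cdE mulE; congr (_ *: _ + _ *: _ + _ *: _); field.
have cdi : idempotent_elt (c + d) by exact: idempotentD.
have Ci i : i != k -> i != l -> C *o J i = 0.
  move=> ik il; apply: (peirce10_mul cdi pC).
  by rewrite jmulDl !ho ?addr0// eq_sym.
have Di i : i != k -> i != l -> D *o J i = 0.
  move=> ik il; apply: (peirce10_mul cdi pD).
  by rewrite jmulDl !ho ?addr0// eq_sym.
have lk : l != k by rewrite eq_sym.
rewrite /rotate -/c -/d -/C -/D; split=> [i|i j ij|].
- case: eqP => _; last case: eqP => _; last by case: fJ.
    by apply/(primitiveP trace_dot); split=> //; rewrite dotE S2 pp; ring.
  by apply/(primitiveP trace_dot); split=> //; rewrite dotE mulrNN S2 pp; ring.
- have [ik|ik] := eqVneq i k; have [jk|jk] := eqVneq j k.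
  + by rewrite ik jk eqxx in ij.
  + by have [//|jl] := eqVneq j l; exact: Ci.
  + have [_|il] := eqVneq i l; first by rewrite jmulC.
    by rewrite jmulC; exact: Ci.
  + have [il|il] := eqVneq i l; have [jl|jl] := eqVneq j l.
    * by rewrite il jl eqxx in ij.
    * exact: Di.
    * by rewrite jmulC; exact: Di.
    * exact: ho.
- rewrite (bigD1 k)//= eqxx (bigD1 l)//= (negbTE lk) eqxx.
  rewrite (eq_bigr J) => [|i /andP[/negbTE-> /negbTE->]//].
  have <- : c + (d + \sum_(i | (i != k) && (i != l)) J i) = jone.
    by rewrite -h1 [RHS](bigD1 k)//= [in RHS](bigD1 l).
  by test_vector t; rewrite pp; ring.
Qed.

End RotatedFrames.

Section Commutation.
Variables (R : realType) (E : ejaType R).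
Hypothesis trace_dot : forall x y : E, jdot x y = jtr (jmul x y).
Local Notation r := (jrank E).
Variable f : 'cV[R]_r -> \bar R.
Hypothesis f_sym : symmetric_function f.
Implicit Types (x y z s c d w : E) (J : 'I_r -> E).

(** The components of [z *o z] lie in the Peirce 1-spaces of [J k] and [J l], which are lines;
    pairing with [J k] and [J l] gives the two coefficients. *)
Lemma half_peirce_square n (J : 'I_n -> E) k l z : jordan_frame J -> k != l ->
  J k *o z = 2^-1 *: z -> J l *o z = 2^-1 *: z ->
  z *o z = (jdot z z / 2) *: (J k + J l).
Proof.
move=> fJ kl; have [hi ho _] := jordan_frame_complete fJ; have [hp _ _] := fJ.
set c := J k; set d := J l => cz dz.
have cc : idempotent_elt c := hi k; have dd : idempotent_elt d := hi l.
have cdi : idempotent_elt (c + d) by apply: idempotentD => //; exact: ho.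
have [m cm] := peirce1_primitive trace_dot (hp k) (peirce_half_sqr cc cz).
have [m' dm] := peirce1_primitive trace_dot (hp l) (peirce_half_sqr dd dz).
have cdz : (c + d) *o z = z by rewrite jmulDl cz dz; test_vector t; field.
have zz : z *o z = m *: c + m' *: d.
  by rewrite -(peirce1_mul cdi cdz cdz) jmulDl cm dm.
have dot_half e : e *o z = 2^-1 *: z -> jdot (z *o z) e = jdot z z / 2.
  by move=> ez; rewrite jdot_assoc jmulC ez jdotZr mulrC.
have c1 : jdot c c = 1 by exact: frame_dot1.
have d1 : jdot d d = 1 by exact: frame_dot1.
have cd0 : jdot c d = 0 by rewrite (complete_dot (jordan_frame_complete fJ)).
have := dot_half _ cz; have := dot_half _ dz.
rewrite zz !jdotE [jdot d c]jdotC c1 d1 cd0 => em' em.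
test_vector t; rewrite -[in RHS]em; have -> : m' = m by lra.
ring.
Qed.

(* The spectral function is constant along the sums of [a] over the frames
   [rotate J k l w p h] with [p^2 + h^2 = 1], and the derivative of these sums
   at [h = 0] is a positive multiple of [w]. *)
Lemma regular_rotation J k l (a : 'cV[R]_r) s w : jordan_frame J -> k != l ->
  a l 0 < a k 0 -> J k *o w = 2^-1 *: w -> J l *o w = 2^-1 *: w ->
  w *o w = J k + J l ->
  regular_subdiff jdot (spectral_function f) (frame_sum J a) s ->
  jdot s w <= 0.
Proof.
move=> fJ kl alk kw lw ww; set x := frame_sum J a.
move=> /(regular_subdiffP (@jdot0r _ _) (@jdot_gt0 _ _))[Fx hF].
rewrite leNgt; apply/negP; set sg := jdot s w => sg0.
have [k0 k00 hk] := hF (sg / 8) ltac:(by rewrite divr_gt0).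
pose al := a k 0 - a l 0; have al0 : 0 < al by rewrite subr_gt0.
pose B := jdot s (J l) - jdot s (J k).
(* The three bounds on [h] ensure p >= 1/2, an increment of norm at most 2 al h < k0, and a
   second-order term h |B| below sg / 8. The subgradient inequality with slack sg / 8 then yields sg
   / 2 < sg / 4 + sg / 8. *)
pose h := Num.min (1 / 2) (Num.min (k0 / (4 * al)) (sg / (8 * (1 + `|B|)))).
have B1 : 0 < 1 + `|B| by rewrite ltr_pwDl.
have h0 : 0 < h by rewrite !lt_min !divr_gt0 ?mulr_gt0.
have h2 : h <= 1 / 2 by rewrite !ge_min lexx.
have h3 : 4 * al * h <= k0.
  by rewrite -ler_pdivlMl ?mulr_gt0// mulrC !ge_min lexx !orbT.
have h4 : 8 * (1 + `|B|) * h <= sg.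
  by rewrite -ler_pdivlMl ?mulr_gt0// mulrC !ge_min lexx !orbT.
pose p := Num.sqrt (1 - h * h).
have p0 : 0 <= p by exact: sqrtr_ge0.
have pp : p * p + h * h = 1.
  by rewrite -!expr2 sqr_sqrtr ?subrK// subr_ge0; nra.
have p2 : 1 / 2 <= p by nra.
have fJ' : jordan_frame (rotate J k l w p h) by exact: rotate_frame.
pose v := al *: (- (h * h) *: J k + (p * h) *: w + (h * h) *: J l).
have xv : frame_sum (rotate J k l w p h) a = x + v.
  have lk : l != k by rewrite eq_sym.
  rewrite /x /frame_sum (bigD1 k)//= [in RHS](bigD1 k)//=.
  rewrite (bigD1 l)//= [in RHS](bigD1 l)//= /rotate eqxx (negbTE lk) eqxx.
  rewrite (eq_bigr (fun i => a i 0 *: J i)) =>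
    [|i /andP[/negbTE-> /negbTE->]//].
  have {}pp : p * p = 1 - h * h by lra.
  by test_vector t; rewrite pp /al; ring.
have vv : jdot v v <= (2 * al * h) ^+ 2.
  have [hi ho _] := jordan_frame_complete fJ.
  have cw0 := half_dot0 (hi k) kw; have dw0 := half_dot0 (hi l) lw.
  have cd0 := complete_dot (jordan_frame_complete fJ) kl.
  have w2 : jdot w w = 2.
    rewrite -[X in jdot X w]jmul1 jdot_assoc ww jdotDr ![jdot jone _]jdotC.
    by rewrite !jdot_one// !frame_dot1.
  rewrite /v !jdotE [jdot w (J k)]jdotC [jdot w (J l)]jdotC
    [jdot (J l) (J k)]jdotC.
  rewrite cw0 dw0 cd0 w2 !frame_dot1//.
  apply: (@le_trans _ _ (2 * al ^+ 2 * h ^+ 2 * (p * p + h * h))).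
    by rewrite le_eqVlt; apply/orP; left; apply/eqP; ring.
  rewrite pp; have := mulr_ge0 (sqr_ge0 al) (sqr_ge0 h); lra.
have nv : dot_norm jdot v <= 2 * al * h.
  rewrite -[leRHS]ger0_norm; last by rewrite !mulr_ge0// ltW.
  by rewrite -sqrtr_sqr ler_wsqrtr.
have vk : dot_norm jdot v < k0 by apply: le_lt_trans nv _; nra.
have := hk v vk; rewrite -xv /x !spectral_frame_sum// -[f a]fineK; last first.
  by move: Fx; rewrite spectral_frame_sum.
rewrite -EFinD lee_fin.
have -> : jdot s v = al * h * (p * sg + h * B).
  by rewrite /v !jdotE -/sg /B; ring.
have := ler_norm (- B); rewrite normrN; set m := `|B| in B1 h4 *.
set nn := dot_norm jdot v in nv vk *.
move=> Bm fin.
have e1 : al * h * (p * sg + h * B) <= sg / 8 * (2 * al * h).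
  apply: le_trans (_ : sg / 8 * nn <= _); first lra.
  by rewrite ler_pM2l// divr_gt0.
have : al * h * (p * sg + h * B) <= al * h * (sg / 4) by lra.
rewrite ler_pM2l ?mulr_gt0// => e2.
have : sg / 2 <= p * sg by rewrite mulrC ler_pM2r//; lra.
have : - (h * B) <= h * m by rewrite -mulrN ler_pM2l.
lra.
Qed.

(** If the component [z] of [s] between [k] and [l] were nonzero, [regular_rotation] along [z],
    scaled so that its square is [J k + J l], would give <s, z> <= 0, whereas <s, z> = 4 <z, z>. *)
Lemma regular_block_diagonal J (a : 'cV[R]_r) s : jordan_frame J ->
  regular_subdiff jdot (spectral_function f) (frame_sum J a) s ->
  block_diagonal J (fun i => a i 0) s.
Proof.
move=> fJ Fs k l; have [hi ho _] := jordan_frame_complete fJ.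
wlog lt_lk : k l / a l 0 < a k 0 => [hw akl|].
  have kl : k != l by apply: contraNneq akl => ->.
  case: (ltgtP (a k 0) (a l 0)) akl => // h _; last by apply: hw;
    rewrite // gt_eqF.
  by rewrite orthogonal_comm// 1?ho 1?eq_sym// hw// gt_eqF.
move=> akl; have kl : k != l by apply: contraNneq akl => ->.
have lk : l != k by rewrite eq_sym.
set z := J l *o (J k *o s); apply/eqP/negPn/negP => z0.
have lz : J l *o z = 2^-1 *: z by rewrite /z orthogonal_half// ho.
have zE : z = J k *o (J l *o s) by rewrite /z orthogonal_comm// ho.
have kz : J k *o z = 2^-1 *: z by rewrite zE orthogonal_half// ho.
have zz := half_peirce_square fJ kl kz lz.
have zz0 := jdot_gt0 z z0.
pose m := Num.sqrt (jdot z z / 2).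
have m0 : 0 < m by rewrite sqrtr_gt0 divr_gt0.
have mm : m * m = jdot z z / 2 by rewrite -expr2 sqr_sqrtr// ltW ?divr_gt0.
pose w := m^-1 *: z.
have : jdot s w <= 0.
  apply: (regular_rotation fJ kl lt_lk) Fs; rewrite /w.
  - by rewrite jmulZr kz !scalerA mulrC.
  - by rewrite jmulZr lz !scalerA mulrC.
  - rewrite jmulZl jmulZr zz -mm !scalerA [X in X *: _](_ : _ = 1) ?scale1r//.
    by field; rewrite gt_eqF.
have szz : jdot z z = 4^-1 * jdot s z.
  rewrite {1}/z [J l *o _]jmulC jdot_assoc lz jdotZr [J k *o s]jmulC
    jdot_assoc kz.
  by rewrite jdotZr; field.
rewrite /w jdotZr; apply/negP; rewrite -ltNge mulr_gt0 ?invr_gt0//; lra.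
Qed.

Lemma regular_common_frame x s :
  regular_subdiff jdot (spectral_function f) x s ->
  exists J, common_frames x s J.
Proof.
have [_ [K fK dx]] := lambdaP trace_dot x; rewrite {1}dx.
move=> /(regular_block_diagonal fK) bs.
have /(resolvable_frame trace_dot)[J [a [b [fJ sa da db]]]] :
  resolvable jone x s.
  exact: (common_resolution trace_dot (jordan_frame_complete fK) dx bs).
exists J; split=> //; [by exists a|by exists b|].
have -> : x = frame_sum J a by [].
by rewrite jdiag_frame_sum// lambda_unique.
Qed.

Lemma regular_spectral x s :
  regular_subdiff jdot (spectral_function f) x s <->
  exists2 J, common_frames x s J &
    regular_subdiff (@euclid_dot R r) f (lambda x) (jdiag s J).
Proof.
split=> [Fs|[J [fJ [a dx] [b ds] dl] fs]].
  have [J xsJ] := regular_common_frame Fs; exists J => //.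
  exact: regular_spectral_restrict.
have {}dx : x = frame_sum J a by [].
have {}ds : s = frame_sum J b by [].
rewrite dx ds; rewrite -dl dx ds !jdiag_frame_sum// in fs.
exact: regular_spectral_extend.
Qed.

End Commutation.

(** * Limits of frames *)

Lemma cvg_increasing_comp (T : topologicalType) (u : nat -> T) (l : T)
    (phi : nat -> nat) :
  increasing_seq phi -> u k @[k --> \oo] --> l -> u (phi k) @[k --> \oo] --> l.
Proof.
move=> phi_incr; apply: cvg_comp => A [N _ NA]; exists N => // k Nk.
apply: NA; apply: leq_trans Nk _ => /=.
have phiS m : (phi m < phi m.+1)%N by move/increasing_seqP : phi_incr; exact.
by elim: k => // k IH; exact: leq_ltn_trans IH (phiS k).
Qed.

Section RealSequences.
Variable R : realType.

Lemma cvg_sum (I : Type) (s : seq I) (F : I -> nat -> R) (l : I -> R) :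
  (forall i, F i k @[k --> \oo] --> l i) ->
  (\sum_(i <- s) F i k) @[k --> \oo] --> \sum_(i <- s) l i.
Proof.
move=> Fl; elim: s => [|i s IH].
  by rewrite big_nil; under eq_fun do rewrite big_nil; exact: cvg_cst.
by rewrite big_cons; under eq_fun do rewrite big_cons; apply: cvgD.
Qed.

(** Subsequences are extracted successively along the enumeration of [I]. *)
Lemma bolzano_weierstrass_family (I : finType) (u : I -> nat -> R) (C : R) :
  (forall i k, `|u i k| <= C) ->
  exists2 phi, increasing_seq phi & forall i, cvgn (u i \o phi).
Proof.
move=> uC.
suff [phi phi_incr hphi] : exists2 phi : nat -> nat, increasing_seq phi &
    forall i, i \in enum I -> cvgn (u i \o phi).
  by exists phi => // i; apply: hphi; rewrite mem_enum.
elim: (enum I) => [|i s [phi phi_incr hphi]]; first by exists id.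
have [|psi psi_incr hpsi] := @bolzano_weierstrass R (u i \o phi).
  exists C; split; first exact: num_real.
  by move=> x Cx k _ /=; apply: le_trans (uC _ _) (ltW Cx).
exists (phi \o psi) => [m n|j]; first by rewrite /= phi_incr -leEnat psi_incr.
rewrite inE => /orP[/eqP ->//|js].
by apply/cvg_ex; have /cvg_ex[l hl] := hphi j js; exists l;
  exact: cvg_increasing_comp hl.
Qed.

End RealSequences.

Section NormConvergence.
Variables (R : realType) (V : lmodType R) (dot : V -> V -> R).
Hypothesis dot_ge0 : forall v, 0 <= dot v v.

Lemma dot_cvgP us u : dot_cvg dot us u <->
  dot (us k - u) (us k - u) @[k --> \oo] --> (0 : R).
Proof.
split=> h.
  rewrite -[X in _ --> X](mulr0 0).
  under eq_fun do rewrite -[dot _ _]sqr_sqrtr// expr2; exact: cvgM.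
rewrite /dot_cvg -[X in _ --> X]sqrtr0.
by apply: (@cvg_comp _ _ _ _ (@Num.sqrt R)) h _; exact: sqrt_continuous.
Qed.

End NormConvergence.

Section WeakConvergence.
Variables (R : realType) (E : ejaType R).
Implicit Types (x y z s c d : E) (us vs : nat -> E).

Lemma cauchy_schwarz x y : `|jdot x y| <= dot_norm jdot x * dot_norm jdot y.
Proof.
rewrite /dot_norm -sqrtrM ?jdot_ge0// -sqrtr_sqr ler_wsqrtr//.
have [->|y0] := eqVneq y 0; first by rewrite !jdot0r mulr0 expr0n.
have := jdot_ge0 (jdot y y *: x - jdot x y *: y).
rewrite !jdotE [jdot y x]jdotC => h.
rewrite -subr_ge0 -(pmulr_rge0 _ (jdot_gt0 y y0)).
by apply: le_trans h _; rewrite le_eqVlt; apply/orP; left; apply/eqP; ring.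
Qed.

(** The map sending [v] to its products with a basis [b] is injective, and [b'] comes from a left
    inverse. Convergence in [E] thus reduces to finitely many real sequences. *)
Lemma exists_dual_basis : exists n (b b' : 'I_n -> E),
  forall v, v = \sum_j jdot (b j) v *: b' j.
Proof.
pose n := \dim (fullv : {vspace E});
  pose b (j : 'I_n) := (vbasis (fullv : {vspace E}))`_j.
pose g v : 'rV[R]_n := \row_j jdot (b j) v.
have g_lin : linear g.
  by move=> a v w; apply/rowP => j; rewrite !mxE jdotDr jdotZr.
pose gL := GRing.isLinear.Build R E 'rV[R]_n _ g g_lin.
pose G : {linear E -> 'rV[R]_n} := HB.pack g gL.
have gK : cancel (linfun G) (linfun G)^-1%VF.
  apply/lker0_lfunK/lker0P => v w; rewrite !lfunE /= => /rowP gvw.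
  suff : jdot (v - w) (v - w) == 0 by rewrite jdot_eq0 subr_eq0 => /eqP.
  rewrite [X in jdot X _](coord_vbasis (memvf (v - w))) jdot_suml big1// => j _.
  have := gvw j; rewrite !mxE => e.
  by rewrite jdotZl jdotDr jdotNr -/(b j) e subrr mulr0.
exists n, b, (fun j => (linfun G)^-1%VF (delta_mx 0 j)) => v.
rewrite -{1}[v]gK lfunE /= [g v]row_sum_delta linear_sum.
by apply: eq_bigr => j _; rewrite linearZ mxE.
Qed.

(** In finite dimension this is equivalent to norm convergence; being stated with [jdot], it passes
    through [jmul] by associativity of the form. *)
Definition weak_cvg us x := forall y, jdot (us k) y @[k --> \oo] --> jdot x y.

Lemma dot_cvg_weak us x : dot_cvg jdot us x -> weak_cvg us x.
Proof.
move=> h y.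
have hy : dot_norm jdot (us k - x) * dot_norm jdot y @[k --> \oo] --> (0 : R).
  by rewrite -[X in _ --> X](mul0r (dot_norm jdot y)); exact: cvgMr_tmp.
have lo : jdot x y - dot_norm jdot (us k - x) * dot_norm jdot y @[k --> \oo]
  --> jdot x y.
  by rewrite -[X in _ --> X]subr0; apply: cvgB => //; exact: cvg_cst.
have hi : jdot x y + dot_norm jdot (us k - x) * dot_norm jdot y @[k --> \oo]
  --> jdot x y.
  by rewrite -[X in _ --> X]addr0; apply: cvgD => //; exact: cvg_cst.
apply: squeeze_cvgr lo hi; apply: nearW => k.
by have := cauchy_schwarz (us k - x) y; rewrite jdotDl jdotNl ler_distl.
Qed.

Lemma weak_cvg_dot us vs x y : weak_cvg us x -> weak_cvg vs y ->
  jdot (us k) (vs k) @[k --> \oo] --> jdot x y.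
Proof.
move=> ux vy; have [n [b [b' bE]]] := exists_dual_basis.
rewrite (bE y) jdot_sumr; under eq_fun do rewrite {1}(bE (vs _)) jdot_sumr.
apply: cvg_sum => j; under eq_fun do rewrite jdotZr.
rewrite jdotZr; apply: cvgM; last exact: ux.
rewrite jdotC; under eq_fun do rewrite jdotC.
exact: vy.
Qed.

Lemma weak_cvg_jmul us vs x y : weak_cvg us x -> weak_cvg vs y ->
  weak_cvg (fun k => us k *o vs k) (x *o y).
Proof.
move=> ux vy t; rewrite jdot_assoc; under eq_fun do rewrite jdot_assoc.
apply: weak_cvg_dot => // w; rewrite jdot_assoc;
  under eq_fun do rewrite jdot_assoc.
exact: vy.
Qed.

Lemma weak_cvg_unique us x y : weak_cvg us x -> weak_cvg us y -> x = y.
Proof.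
by move=> ux uy; apply: jdot_inj => t; exact: (cvg_unique _ (ux t) (uy t)).
Qed.

Lemma weak_cvg_cst x : weak_cvg (fun=> x) x.
Proof. by move=> y; exact: cvg_cst. Qed.

Lemma weak_compactness (I : finType) (u : I -> nat -> E) (C : R) :
  (forall i k, jdot (u i k) (u i k) <= C) ->
  exists phi (l : I -> E), increasing_seq phi /\
    forall i, weak_cvg (fun k => u i (phi k)) (l i).
Proof.
move=> uC; have [n [b [b' bE]]] := exists_dual_basis.
pose w (ij : I * 'I_n) k := jdot (b ij.2) (u ij.1 k).
(* This dominates |<b, u>| <= (|b|^2 + |u|^2) / 2 for all indices at once. *)
pose D := \sum_j jdot (b j) (b j) + `|C|.
have [|phi phi_incr wcvg] := @bolzano_weierstrass_family R _ w D.
  move=> [i j] k; rewrite /w /=.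
  have h1 : jdot (b j) (b j) <= \sum_j jdot (b j) (b j).
    by rewrite (bigD1 j)//= lerDl sumr_ge0// => l _; exact: jdot_ge0.
  have h2 := le_trans (uC i k) (ler_norm C).
  have := jdot_ge0 (b j - u i k); have := jdot_ge0 (b j + u i k).
  have := jdot_ge0 (b j); have := jdot_ge0 (u i k).
  rewrite !jdotE [jdot (u i k) (b j)]jdotC => h3 h4 h5 h6.
  rewrite ler_norml /D; apply/andP; split; lra.
exists phi, (fun i => \sum_j lim (w (i, j) \o phi @ \oo) *: b' j);
  split=> // i y.
rewrite jdot_suml; under eq_fun do rewrite (bE (u i _)) jdot_suml.
apply: cvg_sum => j; rewrite jdotZl; under eq_fun do rewrite jdotZl.
by apply: cvgMr_tmp; exact: wcvg (i, j).
Qed.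

End WeakConvergence.

Section FrameLimits.
Variables (R : realType) (E : ejaType R).
Hypothesis trace_dot : forall x y : E, jdot x y = jtr (jmul x y).
Local Notation r := (jrank E).
Implicit Types (x y z s c d : E).

(** By [primitiveP], being a frame is a set of equations between products and scalar products, all
    continuous. *)
Lemma jordan_frame_closed n (Js : nat -> 'I_n -> E) (K : 'I_n -> E) :
  (forall k, jordan_frame (Js k)) -> (forall i, weak_cvg (Js^~ i) (K i)) ->
  jordan_frame K.
Proof.
move=> fJ JK; have cJ k := jordan_frame_complete (fJ k).
split=> [i|i j ij|].
- apply/(primitiveP trace_dot); split.
    suff h : weak_cvg (Js^~ i) (K i *o K i) by exact: weak_cvg_unique h (JK i).
    rewrite (_ : Js^~ i = fun k => Js k i *o Js k i).
      exact: weak_cvg_jmul (JK i) (JK i).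
    by apply/funext => k; have [-> _ _] := cJ k.
  have := weak_cvg_dot (JK i) (JK i).
  under eq_fun do rewrite (frame_dot1 trace_dot _ (fJ _)).
  by move=> h; exact: (cvg_unique _ h (cvg_cst _)).
- have h := weak_cvg_jmul (JK i) (JK j).
  have e : (fun k => Js k i *o Js k j) = fun=> 0.
    by apply/funext => k; have [_ -> //] := cJ k.
  by rewrite e in h; exact: (weak_cvg_unique h (@weak_cvg_cst _ _ _)).
- have h : weak_cvg (fun k => \sum_i Js k i) (\sum_i K i).
    move=> y; rewrite jdot_suml; under eq_fun do rewrite jdot_suml.
    by apply: cvg_sum => i; exact: JK.
  have e : (fun k => \sum_i Js k i) = fun=> jone.
    by apply/funext => k; case: (cJ k).
  by rewrite e in h; exact: (weak_cvg_unique h (@weak_cvg_cst _ _ _)).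
Qed.

Lemma cvg_lambda (xs : nat -> E) x i : dot_cvg jdot xs x ->
  lambda (xs k) i 0 @[k --> \oo] --> lambda x i 0.
Proof.
move=> xsx.
have lo : lambda x i 0 - dot_norm jdot (xs k - x) @[k --> \oo] --> lambda x i 0.
  by rewrite -[X in _ --> X]subr0; apply: cvgB => //; exact: cvg_cst.
have hi : lambda x i 0 + dot_norm jdot (xs k - x) @[k --> \oo] --> lambda x i 0.
  by rewrite -[X in _ --> X]addr0; apply: cvgD => //; exact: cvg_cst.
apply: squeeze_cvgr lo hi; apply: nearW => k.
rewrite -ler_distl -sqrtr_sqr ler_wsqrtr//.
apply: le_trans (lambda_lipschitz trace_dot (xs k) x).
rewrite /euclid_dot (bigD1 i)//= !mxE -expr2 lerDl sumr_ge0// => j _.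
by rewrite -expr2 sqr_ge0.
Qed.

Lemma common_frame_sum x s (J : 'I_r -> E) : common_frames x s J ->
  [/\ jordan_frame J, jdiag x J = lambda x, x = frame_sum J (jdiag x J) &
      s = frame_sum J (jdiag s J)].
Proof.
move=> [fJ [a dx] [b ds] dl].
have {}dx : x = frame_sum J a by []. have {}ds : s = frame_sum J b by [].
have ea : jdiag x J = a by rewrite dx jdiag_frame_sum.
have eb : jdiag s J = b by rewrite ds jdiag_frame_sum.
by split; rewrite ?ea ?eb// -dl ea.
Qed.

(** Frame elements have norm 1, so a subsequence of the frames converges to a frame. The diagonals
    converge along it, and so do the decompositions of [xs] and [ss]. *)
Lemma common_frames_closed x s (xs ss : nat -> E) (Js : nat -> 'I_r -> E) :
  dot_cvg jdot xs x -> dot_cvg jdot ss s ->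
  (forall k, common_frames (xs k) (ss k) (Js k)) ->
  exists phi K, [/\ increasing_seq phi, common_frames x s K &
    dot_cvg (@euclid_dot R r) (fun k => jdiag (ss (phi k)) (Js (phi k)))
      (jdiag s K)].
Proof.
move=> xsx sss cJ; have fJ k : jordan_frame (Js k) by case: (cJ k).
have [|phi [K [phi_incr JK]]] := @weak_compactness R E _ (fun i k => Js k i) 1.
  by move=> i k; rewrite frame_dot1.
have fK : jordan_frame K.
  exact: (jordan_frame_closed (fun k => fJ (phi k)) JK).
have wx : weak_cvg (xs \o phi) x.
  move=> y; have h := @dot_cvg_weak _ _ _ _ xsx y.
  exact: (cvg_increasing_comp phi_incr h).
have ws : weak_cvg (ss \o phi) s.
  move=> y; have h := @dot_cvg_weak _ _ _ _ sss y.
  exact: (cvg_increasing_comp phi_incr h).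
have diag_cvg zs z i : weak_cvg (zs \o phi) z ->
    jdiag (zs (phi k)) (Js (phi k)) i 0 @[k --> \oo] --> jdiag z K i 0.
  move=> wz; rewrite mxE; under eq_fun do rewrite mxE.
  exact: (weak_cvg_dot (JK i) wz).
have sum_cvg zs z : weak_cvg (zs \o phi) z ->
    (forall k, zs k = frame_sum (Js k) (jdiag (zs k) (Js k))) ->
    z = frame_sum K (jdiag z K).
  move=> wz zsE; apply: (weak_cvg_unique wz) => y.
  rewrite jdot_suml.
  under eq_fun do rewrite /= {1}zsE jdot_suml.
  apply: cvg_sum => i; rewrite jdotZl; under eq_fun do rewrite jdotZl.
  by apply: cvgM; [exact: diag_cvg|exact: JK].
exists phi, K; split=> //.
  split=> //.
  - exists (jdiag x K); apply: (sum_cvg xs) => // k.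
    by case: (common_frame_sum (cJ k)).
  - exists (jdiag s K); apply: (sum_cvg ss) => // k.
    by case: (common_frame_sum (cJ k)).
  - apply/colP => i; have h := diag_cvg xs x i wx.
    have e : (fun k => jdiag (xs (phi k)) (Js (phi k)) i 0) =
        fun k => lambda (xs (phi k)) i 0.
      by apply/funext => k; have [_ _ _ ->] := cJ (phi k).
    rewrite e in h.
    suff hl : lambda (xs (phi k)) i 0 @[k --> \oo] --> lambda x i 0.
      exact: (cvg_unique _ h hl).
    by apply: (@cvg_increasing_comp _ (fun k => lambda (xs k) i 0)) => //;
      exact: cvg_lambda.
apply/(dot_cvgP (@euclid_dot_ge0 _ _)).
rewrite -[X in _ --> X](_ : \sum_(i < r) 0 = 0); last by rewrite big1.
apply: cvg_sum => i.
rewrite -[X in _ --> X](mulr0 0).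
suff h : (jdiag (ss (phi k)) (Js (phi k)) - jdiag s K) i 0 @[k --> \oo] -->
    (0 : R).
  exact: cvgM.
rewrite -[X in _ --> X](subrr (jdiag s K i 0)).
rewrite (_ : (fun k => _) =
  fun k => jdiag (ss (phi k)) (Js (phi k)) i 0 - jdiag s K i 0).
  by apply: cvgB; [exact: diag_cvg|exact: cvg_cst].
by apply/funext => k; rewrite !mxE.
Qed.

End FrameLimits.

(** * Approximate and horizon subdifferentials *)

Section SpectralSubdifferentials.
Variables (R : realType) (E : ejaType R).
Hypothesis trace_dot : forall x y : E, jdot x y = jtr (jmul x y).
Local Notation r := (jrank E).
Variable f : 'cV[R]_r -> \bar R.
Hypothesis f_sym : symmetric_function f.
Implicit Types (x y z s c d w : E) (J : 'I_r -> E).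

Lemma frame_sum_dot_cvg J (us : nat -> 'cV[R]_r) u : jordan_frame J ->
  dot_cvg (@euclid_dot R r) us u ->
  dot_cvg jdot (fun k => frame_sum J (us k)) (frame_sum J u).
Proof.
move=> fJ /(dot_cvgP (@euclid_dot_ge0 _ _)) h.
apply/(dot_cvgP (@jdot_ge0 _ _)).
rewrite (_ : (fun k => _) = fun k => euclid_dot (us k - u) (us k - u))//.
apply/funext => k; rewrite -(frame_sum_dot trace_dot _ _ fJ) frame_sumD.
by rewrite -[- u]scaleN1r frame_sumZ scaleN1r.
Qed.

Lemma lambda_dot_cvg (xs : nat -> E) x : dot_cvg jdot xs x ->
  dot_cvg (@euclid_dot R r) (fun k => lambda (xs k)) (lambda x).
Proof.
have z : (fun=> 0 : R) k @[k --> \oo] --> (0 : R) by exact: cvg_cst.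
apply: (squeeze_cvgr _ z); apply: nearW => k.
by rewrite sqrtr_ge0 ler_wsqrtr//; exact: lambda_lipschitz.
Qed.

Lemma jdiagZ a s J : jdiag (a *: s) J = a *: jdiag s J.
Proof. by apply/colP => i; rewrite !mxE jdotZr. Qed.

Lemma common_framesZ a x s J : common_frames x s J ->
  common_frames x (a *: s) J.
Proof.
move=> [fJ dx [b ds] dl]; split=> //; exists (a *: b).
by rewrite /diagonalizes_with -/(frame_sum J _) frame_sumZ
  -/(diagonalizes_with _ _ _) ds.
Qed.

Lemma regular_spectral_choice (xs ss : nat -> E) :
  (forall k, regular_subdiff jdot (spectral_function f) (xs k) (ss k)) ->
  exists Js, forall k, common_frames (xs k) (ss k) (Js k) /\
    regular_subdiff (@euclid_dot R r) f (lambda (xs k)) (jdiag (ss k) (Js k)).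
Proof.
move=> reg; have [k|Js hJs] :=
  @boolp.choice _ _ (fun k J => common_frames (xs k) (ss k) J /\
    regular_subdiff (@euclid_dot R r) f (lambda (xs k)) (jdiag (ss k) J)).
  have [J xsJ fJ] := (regular_spectral trace_dot f_sym _ _).1 (reg k).
  by exists J.
by exists Js.
Qed.

(** From [F] to [f], the common frames vary with the index and a convergent subsequence is
    extracted; from [f] to [F], the one frame [J] lifts both sequences. *)
Lemma approximate_spectral x s :
  approximate_subdiff jdot (spectral_function f) x s <->
  exists2 J, common_frames x s J &
    approximate_subdiff (@euclid_dot R r) f (lambda x) (jdiag s J).
Proof.
split=> [[Fx [xs [ss [xsx sss Fxs reg]]]]|
  [J xsJ [fx [us [ds [usx dss fus reg]]]]]].
  have [Js /all_and2[cJ rJ]] := regular_spectral_choice reg.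
  have [phi [K [phi_incr xsK dK]]] := common_frames_closed trace_dot xsx sss cJ.
  exists K => //; split=> //.
  exists (fun k => lambda (xs (phi k))).
  exists (fun k => jdiag (ss (phi k)) (Js (phi k))).
  split=> //.
    exact: (cvg_increasing_comp phi_incr (lambda_dot_cvg xsx)).
  exact: (cvg_increasing_comp phi_incr Fxs).
have [fJ dl dx ds'] := common_frame_sum trace_dot xsJ; rewrite dl in dx.
split=> //; exists (fun k => frame_sum J (us k)), (fun k => frame_sum J (ds k)).
split=> [|||k].
- by rewrite dx; exact: frame_sum_dot_cvg.
- by rewrite ds'; exact: frame_sum_dot_cvg.
- by under eq_fun do rewrite spectral_frame_sum//.
- exact: regular_spectral_extend.
Qed.

Lemma horizon_spectral x s :
  horizon_subdiff jdot (spectral_function f) x s <->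
  exists2 J, common_frames x s J &
    horizon_subdiff (@euclid_dot R r) f (lambda x) (jdiag s J).
Proof.
split=> [[Fx [xs [ss [t [xsx Fxs reg [t0 tdec t_cvg] tss]]]]]|].
  have [Js /all_and2[cJ rJ]] := regular_spectral_choice reg.
  (* The subgradients [ss k] may be unbounded; the limit is taken on the scaled sequence, which the
     same frames diagonalize. *)
  have cJ' k := common_framesZ (t k) (cJ k).
  have [phi [K [phi_incr xsK dK]]] :=
    common_frames_closed trace_dot xsx tss cJ'.
  exists K => //; split=> //.
  exists (fun k => lambda (xs (phi k))).
  exists (fun k => jdiag (ss (phi k)) (Js (phi k))), (t \o phi).
  split=> //.
  - exact: (cvg_increasing_comp phi_incr (lambda_dot_cvg xsx)).
  - exact: (cvg_increasing_comp phi_incr Fxs).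
  - split=> [k|m n mn|]; first exact: t0.
      by apply: tdec; rewrite -leEnat phi_incr.
    exact: (cvg_increasing_comp phi_incr t_cvg).
  - rewrite (_ : (fun k => _) =
        fun k => jdiag (t (phi k) *: ss (phi k)) (Js (phi k)))//.
    by apply/funext => k; rewrite jdiagZ.
move=> [J xsJ [fx [us [ds [t [usx fus reg ht tds]]]]]].
have [fJ dl dx ds'] := common_frame_sum trace_dot xsJ; rewrite dl in dx.
split=> //; exists (fun k => frame_sum J (us k)).
exists (fun k => frame_sum J (ds k)), t.
split=> [||k||] //.
- by rewrite dx; exact: frame_sum_dot_cvg.
- by under eq_fun do rewrite spectral_frame_sum//.
- exact: regular_spectral_extend.
- rewrite ds' (_ : (fun k => _) = fun k => frame_sum J (t k *: ds k)).
    exact: frame_sum_dot_cvg.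
  by apply/funext => k; rewrite frame_sumZ.
Qed.

End SpectralSubdifferentials.

Theorem theorem17 (R : realType) (E : ejaType R)
  (trace_dot : forall x y : E, jdot x y = jtr (jmul x y))
  (f : 'cV[R]_(jrank E) -> \bar R) (f_sym : symmetric_function f)
  (D : subdiff_kind) (x : E) :
  subdiff D jdot (spectral_function f) x =
  [set s : E | exists2 J, common_frames x s J &
                 subdiff D (@euclid_dot R (jrank E)) f (lambda x) (jdiag s J)].
Proof.
apply/seteqP; case: D; split=> s /=.
- by move/(regular_spectral trace_dot f_sym).
- by move/(regular_spectral trace_dot f_sym).
- by move/(approximate_spectral trace_dot f_sym).
- by move/(approximate_spectral trace_dot f_sym).
- by move/(horizon_spectral trace_dot f_sym).
- by move/(horizon_spectral trace_dot f_sym).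
Qed.
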